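(* Let $0<T<T_h$ and let $P(0,T)>0$ and $P(0,T_h)>0$ be given constants. The process $$\Big(\frac{P(0,T)}{P(0,T_h)}\Big)^{\left[\frac{2M_t}{2+A_t\log [P(0,T)/P(0,T_h)]}\right]},\qquad 0\le t\le T,$$ is a positive local martingale if and only if $P(0,T)\ge P(0,T_h)$.
   Context: $B_t$ is a standard Brownian motion (started at $0$), with its filtration $(\mathcal F_t)$; $M_t=\exp(B_t-\tfrac t2)$ and $A_t=\int_0^t M_s\,ds$. The process in the claim is the paper's definition of the discounted $T$-maturity bond price $P(t,T)/P(t,T_h)$, where $T_h$ is a fixed horizon date and $P(0,T)$, $P(0,T_h)$ are observed (positive, deterministic) bond prices at time $0$. *)

(* Defs.v *)
From HB Require Import structures.
From mathcomp Require Import all_boot all_order all_algebra.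
From mathcomp Require Import all_classical all_reals all_analysis.

Set Implicit Arguments.
Unset Strict Implicit.
Unset Printing Implicit Defensive.

Import Order.TTheory GRing.Theory Num.Theory.
Import numFieldNormedType.Exports.

Local Open Scope classical_set_scope.
Local Open Scope ring_scope.

(* A continuous-time process is a function [R -> Omega -> R], and a filtration
   a function from R to sets of events; only times t >= 0 matter, and what
   either one does at negative times is left unconstrained. *)

Section Processes.
Context {d : measure_display} {Omega : measurableType d} {R : realType}.
Variable P : probability Omega R.

Definition is_filtration (F : R -> set (set Omega)) : Prop :=
  [/\ forall t, 0 <= t -> sigma_algebra setT (F t),
      forall t, 0 <= t -> F t `<=` measurable
    & forall s t, 0 <= s -> s <= t -> F s `<=` F t].

Definition measurable_wrt (G : set (set Omega)) (Y : Omega -> R) : Prop :=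
  forall D : set R, measurable D -> G (Y @^-1` D).

Definition independent_of (G : set (set Omega)) (Y : Omega -> R) : Prop :=
  forall (E : set Omega) (D : set R), G E -> measurable D ->
    P (E `&` Y @^-1` D) = (P E * P (Y @^-1` D))%E.

(* Standard Brownian motion {B_t, F_t}. The second parameter of [normal_prob]
   is the standard deviation. *)
Definition standard_brownian_motion (F : R -> set (set Omega))
    (B : R -> Omega -> R) : Prop :=
  [/\ forall t, 0 <= t -> measurable_wrt (F t) (B t),
      {ae P, forall w, B 0 w = 0},
      forall w, {within `[0, +oo[%classic, continuous (fun t => B t w)},
      forall s t, 0 <= s -> s < t ->
        independent_of (F s) (fun w => B t w - B s w)
    & forall s t, 0 <= s -> s < t -> forall D : set R, measurable D ->
        P ((fun w => B t w - B s w) @^-1` D)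
        = normal_prob 0 (Num.sqrt (t - s)) D].

(* [Z] is a version of the conditional expectation E[Y | G]. *)
Definition is_cond_expectation (G : set (set Omega)) (Y Z : Omega -> R) : Prop :=
  [/\ P.-integrable setT (EFin \o Y),
      P.-integrable setT (EFin \o Z),
      measurable_wrt G Z
    & forall E, G E -> \int[P]_(w in E) Z w = \int[P]_(w in E) Y w].

Definition adapted (F : R -> set (set Omega)) (T : R) (X : R -> Omega -> R) :
    Prop :=
  forall t, 0 <= t <= T -> measurable_wrt (F t) (X t).

Definition martingale (F : R -> set (set Omega)) (T : R) (X : R -> Omega -> R) :
    Prop :=
  [/\ adapted F T X,
      forall t, 0 <= t <= T -> P.-integrable setT (EFin \o X t)
    & forall s t, 0 <= s -> s <= t -> t <= T ->
        is_cond_expectation (F s) (X t) (X s)].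

Definition stopping_time (F : R -> set (set Omega)) (tau : Omega -> \bar R) :
    Prop :=
  (forall w, 0 <= tau w)%E /\
  forall t, 0 <= t -> F t [set w | (tau w <= t%:E)%E].

(* The minimum is finite as soon as t and tau are nonnegative. *)
Definition stopped (X : R -> Omega -> R) (tau : Omega -> \bar R) :
    R -> Omega -> R :=
  fun t w => X (fine (Order.min t%:E (tau w))) w.

Definition cadlag (T : R) (x : R -> R) : Prop :=
  (forall t, 0 <= t < T -> x s @[s --> t^'+] --> x t) /\
  (forall t, 0 < t <= T -> cvg (x s @[s --> t^'-])).

(* Since the localizing times increase to +oo, rather than to T, almost every
   path of the stopped process eventually agrees with that of X on the whole
   of the closed interval [0, T]. *)
Definition local_martingale (F : R -> set (set Omega)) (T : R)
    (X : R -> Omega -> R) : Prop :=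
  [/\ adapted F T X,
      {ae P, forall w, cadlag T (fun t => X t w)}
    & exists tau : nat -> Omega -> \bar R,
      [/\ forall n, stopping_time F (tau n),
          {ae P, forall w, forall n, (tau n w <= tau n.+1 w)%E},
          {ae P, forall w, tau n w @[n --> \oo] --> +oo%E}
        & forall n, martingale F T (stopped X (tau n))]].

Definition positive_local_martingale (F : R -> set (set Omega)) (T : R)
    (X : R -> Omega -> R) : Prop :=
  (forall t w, 0 <= t <= T -> 0 < X t w) /\ local_martingale F T X.

End Processes.

Section BondPrice.
Context {Omega : Type} {R : realType}.
Variable B : R -> Omega -> R.

Definition exp_mart (t : R) (w : Omega) : R := expR (B t w - t / 2).

Definition exp_functional (t : R) (w : Omega) : R :=
  \int[lebesgue_measure]_(s in `[0, t]) exp_mart s w.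

(* The discounted bond price, with p = P(0,T) and ph = P(0,T_h). If p < ph the
   denominator can vanish; the value there is a convention (the inverse of 0
   is 0, so the power is 1), but the path explodes to +oo immediately after
   such a time. *)
Definition discounted_bond (p ph : R) (t : R) (w : Omega) : R :=
  (p / ph) `^ ((2 * exp_mart t w) / (2 + exp_functional t w * ln (p / ph))).

End BondPrice.

(* Main.v *)
(* Write [c = ln (p / ph)], [Y = 2 M / (2 + c A)], so that the process is
   [exp (c Y)].  On a grid of mesh [h], replacing [A] by its left Riemann sum
   turns [Y] into a recursion [y |-> y e^(W - h/2) / (1 + (c/2) y h)] driven by
   the increment [W ~ N(0, h)] alone, which is independent of the past.
   Lognormal moments and a Taylor expansion show that [exp (c Y)], truncated
   above the level at which [B] is stopped, changes in mean by only
   [O(h^(3/2))] in one step; the first- and second-order terms of [c Y] cancel.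
   Summing over the grid and letting [h] go to 0 gives the martingale property
   of the process stopped when [B] hits [n], with no stochastic integral.

   If [c < 0], the process blows up right after the time at which
   [2 + c A = 0], so it is not cadlag on the event that this happens before
   [T].  That event has positive probability because [A_T] is unbounded: given
   that [B_(T/2)] is large, [E[\int e^(-(B_u - B_(T/2))) du]] over [[T/2, T]] stays
   bounded by independence, which bounds the increase of [A] from below. *)

Require Import Defs.
From HB Require Import structures.
From mathcomp Require Import all_boot all_order all_algebra.
From mathcomp Require Import all_classical all_reals all_analysis.
From mathcomp Require Import measurable_realfun ring lra.
Import Order.TTheory GRing.Theory Num.Theory.
Import numFieldNormedType.Exports.
Local Open Scope classical_set_scope.
Local Open Scope ring_scope.

(** * Gaussian moments *)

(** The obstacle is that for [c > 0] the variable [e^(c y)] has no finite mean when [y] is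
    lognormal, so one step past the stopping level already leaves the integrable range. Truncation
    repairs this because [Y <= M <= e^B] when [c >= 0]: a bound [B <= n] keeps the exponent below
    [e^n], one unit under the truncation level, so in the limit of fine grids the truncation is
    almost surely inactive on the stopped path. The left Riemann sum makes the new exponent a
    function of the old one and the increment, so a single Gaussian integral with [y] frozen decides
    each step. The cancellation is that of Ito's formula: the denominator gives [c Y] the drift
    [- (c y)^2 h / 2], and the variance of the noise contributes [+ (c y)^2 h / 2]. The power 3/2
    comes from a cubic Taylor remainder with increments of size [h^(1/2)]; it is enough because the
    number of steps is of order [1 / h]. *)

Lemma ge0_integral_normal_prob (R : realType) (m s : R) (f : R -> R) :
  (forall x, 0 <= f x) -> measurable_fun setT f ->
  (\int[normal_prob m s]_x (f x)%:E
   = \int[lebesgue_measure]_x ((f x)%:E * (normal_pdf m s x)%:E))%E.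
Proof.
move=> f0 /measurable_EFinP mf.
have dom := normal_prob_dominates m s.
rewrite -(Radon_Nikodym_SigmaFinite.change_of_variables dom)//.
apply: ae_eq_integral => //.
- apply: emeasurable_funM => //.
  exact: measurable_int (Radon_Nikodym_SigmaFinite.f_integrable dom).
- apply: emeasurable_funM => //; apply/measurable_EFinP.
  exact: measurable_normal_pdf.
(* The Radon-Nikodym derivative and [normal_pdf] have the same integral over every measurable set,
   so they agree almost everywhere. *)
- apply: ae_eqe_mul2l; apply: integral_ae_eq => //.
  + exact: Radon_Nikodym_SigmaFinite.f_integrable.
  + by apply/measurable_EFinP; exact: measurable_normal_pdf.
  + by move=> E E01 mE; rewrite -Radon_Nikodym_SigmaFinite.f_integral.
Qed.

(* Completing the square: [e^(k x)] times the centred density is a multiple of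
   the density centred at [k s^2]. *)
Lemma normal_mgf (R : realType) (s k : R) : s != 0 ->
  (\int[normal_prob 0 s]_x (expR (k * x))%:E
   = (expR (k ^+ 2 * s ^+ 2 / 2))%:E)%E.
Proof.
move=> s0; rewrite ge0_integral_normal_prob; first last.
- by apply: measurableT_comp => //; exact: mulrl_measurable.
- by move=> x; exact: expR_ge0.
rewrite (_ : (fun x => _) = fun x =>
  ((expR (k ^+ 2 * s ^+ 2 / 2))%:E * (normal_pdf (k * s ^+ 2) s x)%:E)%E).
  rewrite integralZl//; last exact: integrable_normal_pdf.
  by rewrite integral_normal_pdf mule1.
apply/funext => x; rewrite -!EFinM !normal_pdfE// /normal_fun.
congr EFin; rewrite mulrCA [RHS]mulrCA -!expRD; congr (_ * expR _).
by field.
Qed.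

(** The joint law of [(Y, W)] agrees on rectangles with the product of the law of [Y] and [nu],
    hence everywhere; by Tonelli, [Y] may be frozen while [W] is integrated out. *)
Lemma independent_integral d d1 d2 (Omega : measurableType d)
    (T1 : measurableType d1) (T2 : measurableType d2) (R : realType)
    (P : probability Omega R) (Y : Omega -> T1) (W : Omega -> T2)
    (nu : probability T2 R) (f : T1 * T2 -> R) :
  measurable_fun setT Y -> measurable_fun setT W ->
  (forall A D, measurable A -> measurable D ->
    P (Y @^-1` A `&` W @^-1` D) = P (Y @^-1` A) * nu D)%E ->
  (forall z, 0 <= f z) -> measurable_fun setT f ->
  (\int[P]_w (f (Y w, W w))%:E = \int[P]_w \int[nu]_x (f (Y w, x))%:E)%E.
Proof.
move=> mY mW ind f0 mf.
pose Ym : {mfun Omega >-> T1} :=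
  HB.pack Y (isMeasurableFun.Build _ _ _ _ _ mY).
have mYW : measurable_fun setT (fun w => (Y w, W w)).
  exact/measurable_fun_pair.
pose YWm : {mfun Omega >-> (T1 * T2)%type} :=
  HB.pack (fun w => (Y w, W w)) (isMeasurableFun.Build _ _ _ _ _ mYW).
have mf' : measurable_fun setT (EFin \o f) by exact/measurable_EFinP.
transitivity (\int[pushforward P YWm]_z (EFin \o f) z)%E.
  by rewrite ge0_integral_pushforward// => z _; rewrite lee_fin.
transitivity (\int[(distribution P Ym \x nu)%E]_z (EFin \o f) z)%E.
  apply: eq_measure_integral => A mA _; symmetry.
  exact: product_measure_unique.
rewrite fubini_tonelli1//.
rewrite /distribution ge0_integral_pushforward//.
- by apply: measurable_fun_fubini_tonelli_F => // z; rewrite lee_fin.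
- by move=> y _; apply: integral_ge0 => z _; rewrite lee_fin.
Qed.

(** Both signs of [x] are covered at once; [|c| <= |x|] is what iterating the mean value theorem in
    a Taylor bound requires. *)
Lemma MVT_from0 (R : realType) (f df : R -> R) (x : R) :
  (forall y : R, is_derive y 1 f (df y)) ->
  exists2 c, `|c| <= `|x| & f x - f 0 = df c * x.
Proof.
move=> fdf.
have cf a b : {within `[a, b], continuous f}.
  apply: continuous_subspaceT => y; apply: differentiable_continuous.
  by apply/derivable1_diffP; case: (fdf y).
have [x0|x0] := leP 0 x.
  have [c] := MVT_segment x0 (fun y _ => fdf y) (cf _ _).
  rewrite in_itv/= => /andP[c0 cx] ->; exists c; last by rewrite subr0.
  by rewrite !ger0_norm.
have [c] := MVT_segment (ltW x0) (fun y _ => fdf y) (cf _ _).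
rewrite in_itv/= => /andP[xc c0] E; exists c.
  by rewrite !ler0_norm ?lerN2// ltW.
by rewrite -opprB E; ring.
Qed.

(** Three applications of the mean value theorem to successive derivatives each yield a factor at
    most [|x|]; the constant 1/6 is given up. *)
Lemma expR_taylor2 (R : realType) (x : R) :
  `|expR x - (1 + x + x ^+ 2 / 2)| <= `|x| ^+ 3 * expR `|x|.
Proof.
have d1 (y : R) : is_derive y 1 (fun z => expR z - (1 + z + z ^+ 2 / 2))
    (expR y - (1 + y)).
  by apply: is_derive_eq; rewrite /GRing.scale/=; field.
have d2 (y : R) : is_derive y 1 (fun z => expR z - (1 + z)) (expR y - 1).
  by apply: is_derive_eq; rewrite /GRing.scale/=; field.
have [c1 c1x] := @MVT_from0 R _ _ x d1.
have [c2 c21] := @MVT_from0 R _ _ c1 d2.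
have [c3 c32] := @MVT_from0 R _ _ c2 (@is_derive_expR R).
rewrite !expR0 expr0n/= mul0r !addr0 subrr !subr0 => -> -> ->.
rewrite !normrM (ger0_norm (expR_ge0 _)).
have c2x := le_trans c21 c1x.
rewrite [leRHS](_ : _ = expR `|x| * `|x| * `|x| * `|x|); last by ring.
rewrite !ler_pM ?mulr_ge0 ?expR_ge0// ler_expR.
by rewrite (le_trans (ler_norm _))// (le_trans c32).
Qed.

(** The factor by which [exp_mart] is multiplied over a time step [h] with Brownian increment [w];
    its mean under N(0, h) is 1. *)
Definition lognormal {R : realType} (h w : R) : R := expR (w - h / 2).

(** Nested to the right with every power explicit, [x ^+ 0] included, so that linearity of the
    integral peels off one uniform monomial at a time. *)
Definition quartic {R : realType} (a0 a1 a2 a3 a4 x : R) : R :=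
  a0 * x ^+ 0 + (a1 * x ^+ 1 + (a2 * x ^+ 2 + (a3 * x ^+ 3 + a4 * x ^+ 4))).

(** * Lognormal moments *)

Section lognormal_moments.
Context {R : realType}.
Variable h : R.
Hypothesis h0 : 0 < h.
Local Notation nu := (normal_prob 0 (Num.sqrt h)).
Local Notation xi := (lognormal h).

Lemma measurable_lognormal : measurable_fun setT xi.
Proof. by apply: measurableT_comp => //; exact: measurable_funD. Qed.

Lemma integral_lognormalX k :
  (\int[nu]_w (xi w ^+ k)%:E = (expR ((k%:R ^+ 2 - k%:R) * h / 2))%:E)%E.
Proof.
have s0 : Num.sqrt h != 0 by rewrite gt_eqF// sqrtr_gt0.
rewrite (_ : (fun w => _) = fun w : R =>
  ((expR (- k%:R * h / 2))%:E * (expR (k%:R * w))%:E)%E); last first.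
  apply/funext => w; rewrite -EFinM -expRD -expRM_natl; congr (expR _)%:E.
  by rewrite mulrBr addrC mulrA !mulNr.
rewrite ge0_integralZl//; last first.
  by apply/measurable_EFinP; apply: measurableT_comp.
rewrite normal_mgf// -EFinM -expRD sqr_sqrtr ?ltW//; congr (expR _)%:E.
by field.
Qed.

Lemma integrable_lognormalX k : nu.-integrable setT (fun w => (xi w ^+ k)%:E).
Proof.
apply/integrableP; split.
  by apply/measurable_EFinP; apply: measurable_funX; exact: measurable_lognormal.
under eq_integral do rewrite gee0_abs ?lee_fin ?exprn_ge0 ?expR_ge0//.
by rewrite integral_lognormalX ltry.
Qed.

Lemma Rintegral_lognormalX k :
  \int[nu]_w (xi w ^+ k) = expR ((k%:R ^+ 2 - k%:R) * h / 2).
Proof. by rewrite /Rintegral integral_lognormalX. Qed.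

Let intZ a k : nu.-integrable setT (EFin \o (fun w => a * xi w ^+ k)).
Proof.
rewrite (_ : _ \o _ = fun w => (a%:E * (xi w ^+ k)%:E)%E)//.
exact: integrableZl (integrable_lognormalX k).
Qed.

Let intD (f g : R -> R) : nu.-integrable setT (EFin \o f) ->
  nu.-integrable setT (EFin \o g) ->
  nu.-integrable setT (EFin \o (fun w => f w + g w)).
Proof. by move=> intf intg; have := integrableD measurableT intf intg. Qed.

Lemma integrable_lognormal_quartic a0 a1 a2 a3 a4 :
  nu.-integrable setT (EFin \o (fun w => quartic a0 a1 a2 a3 a4 (xi w))).
Proof.
rewrite /quartic; exact: (intD _ _ (intZ _ _) (intD _ _ (intZ _ _)
  (intD _ _ (intZ _ _) (intD _ _ (intZ _ _) (intZ _ _))))).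
Qed.

(** The exponents 0, 0, 1, 3, 6 are [(k^2 - k) / 2] for [k] from 0 to 4. *)
Lemma Rintegral_lognormal_quartic a0 a1 a2 a3 a4 :
  \int[nu]_w (quartic a0 a1 a2 a3 a4 (xi w))
  = a0 + a1 + a2 * expR h + a3 * expR (3 * h) + a4 * expR (6 * h).
Proof.
have E a k : \int[nu]_w (a * xi w ^+ k)
    = a * expR ((k%:R ^+ 2 - k%:R) * h / 2).
  by rewrite RintegralZl ?Rintegral_lognormalX//; exact: integrable_lognormalX.
rewrite /quartic RintegralD//; last exact: (intD _ _ (intZ _ _)
  (intD _ _ (intZ _ _) (intD _ _ (intZ _ _) (intZ _ _)))).
rewrite RintegralD//; last exact: (intD _ _ (intZ _ _)
  (intD _ _ (intZ _ _) (intZ _ _))).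
rewrite RintegralD//; last exact: (intD _ _ (intZ _ _) (intZ _ _)).
rewrite RintegralD// !E !addrA.
rewrite (_ : (0%:R ^+ 2 - 0%:R) * h / 2 = 0); last by field.
rewrite (_ : (1%:R ^+ 2 - 1%:R) * h / 2 = 0); last by field.
rewrite (_ : (2%:R ^+ 2 - 2%:R) * h / 2 = h); last by field.
rewrite (_ : (3%:R ^+ 2 - 3%:R) * h / 2 = 3 * h); last by field.
rewrite (_ : (4%:R ^+ 2 - 4%:R) * h / 2 = 6 * h); last by field.
by rewrite expR0 !mulr1.
Qed.

End lognormal_moments.

(** * One step of the scheme *)

Lemma integrable_of_bounded d (T : measurableType d) (R : realType)
    (mu : {finite_measure set T -> \bar R}) (f : T -> R) (M : R) :
  measurable_fun setT f -> (forall x, `|f x| <= M) ->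
  mu.-integrable setT (EFin \o f).
Proof.
move=> mf fM; apply: (@le_integrable _ _ _ _ _ measurableT _ (EFin \o cst M)).
- exact/measurable_EFinP.
- move=> x _ /=; rewrite lee_fin (le_trans (fM x))// ler_norm//.
- exact: finite_measure_integrable_cst.
Qed.

(* The truncation is needed because [e^(c y)] is not integrable against a
   lognormal law. *)
Definition truncexp {R : realType} (c K y : R) : R := expR (c * Num.min y (K + 1)).

Lemma truncexp_gt0 (R : realType) (c K y : R) : 0 < truncexp c K y.
Proof. exact: expR_gt0. Qed.

Lemma truncexp_le (R : realType) (c K y : R) : 0 <= c ->
  truncexp c K y <= expR (c * (K + 1)).
Proof. by move=> c0; rewrite ler_expR ler_wpM2l// ge_min lexx orbT. Qed.

Lemma truncexpE (R : realType) (c K y : R) : y <= K + 1 ->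
  truncexp c K y = expR (c * y).
Proof. by move=> yK; rewrite /truncexp min_l. Qed.

Lemma continuous_truncexp (R : realType) (c K : R) : continuous (truncexp c K).
Proof.
move=> y; apply: (@continuous_comp _ _ _ (fun y => c * Num.min y (K + 1)) expR).
  apply: cvgM; first exact: cvg_cst.
  by apply: (@continuous_min R R id (cst (K + 1))) => //; exact: cvg_cst.
exact: continuous_expR.
Qed.

Lemma measurable_truncexp (R : realType) (c K : R) :
  measurable_fun setT (truncexp c K).
Proof. by apply: continuous_measurable_fun; exact: continuous_truncexp. Qed.

(** For [|D| <= 1] the point [y + D] stays below the truncation level [K + 1], and the bound is
    Taylor's, with the first summand of the constant. For [|D| > 1] lower powers of [|D|] are
    dominated by the cube; the other two summands bound the truncated exponential and the polynomial
    separately. *)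
Lemma truncexp_taylor2 (R : realType) (c K : R) : 0 <= c -> 0 <= K ->
  exists2 C, 0 <= C & forall y D : R, 0 <= y <= K ->
    `|truncexp c K (y + D) - expR (c * y) * (1 + c * D + (c * D) ^+ 2 / 2)|
    <= C * `|D| ^+ 3.
Proof.
move=> c0 K0.
exists (expR (c * K) * c ^+ 3 * expR c + expR (c * (K + 1))
  + expR (c * K) * (1 + c + c ^+ 2)).
  by rewrite !addr_ge0 ?mulr_ge0 ?addr_ge0 ?expR_ge0 ?sqr_ge0// exprn_ge0.
move=> y D /andP[y0 yK].
have eyK : expR (c * y) <= expR (c * K) by rewrite ler_expR ler_wpM2l.
have D0 : 0 <= `|D| by [].
have [D1|D1] := leP `|D| 1.
  rewrite truncexpE; last first.
    by rewrite lerD// (le_trans (ler_norm _)).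
  rewrite mulrDr expRD -mulrBr normrM ger0_norm ?expR_ge0//.
  have T := expR_taylor2 R (c * D).
  apply: (@le_trans _ _ (expR (c * K) * (`|c * D| ^+ 3 * expR `|c * D|))).
    by rewrite ler_pM ?expR_ge0.
  have -> : `|c * D| = c * `|D| by rewrite normrM ger0_norm.
  have e1 : expR (c * `|D|) <= expR c by rewrite ler_expR ler_piMr.
  apply: (@le_trans _ _ (expR (c * K) * c ^+ 3 * expR c * `|D| ^+ 3)).
    rewrite exprMn [leRHS](_ : _ =
      expR (c * K) * (c ^+ 3 * `|D| ^+ 3 * expR c)); last by ring.
    by rewrite ler_wpM2l ?expR_ge0// ler_wpM2l// mulr_ge0 ?exprn_ge0.
  rewrite ler_wpM2r ?exprn_ge0// -addrA lerDl addr_ge0 ?expR_ge0//.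
  by rewrite mulr_ge0 ?expR_ge0// !addr_ge0// exprn_ge0.
have D3 k : (k <= 3)%N -> `|D| ^+ k <= `|D| ^+ 3.
  by move=> k3; rewrite ler_weXn2l// ltW.
apply: (le_trans (ler_normB _ _)).
rewrite ger0_norm ?expR_ge0// normrM ger0_norm ?expR_ge0//.
have := truncexp_le R c K (y + D) c0 => h1.
have h2 : `|1 + c * D + (c * D) ^+ 2 / 2| <= (1 + c + c ^+ 2) * `|D| ^+ 3.
  rewrite (le_trans (ler_normD _ _))//.
  have h3 := ler_normD 1 (c * D).
  rewrite normr1 [`|c * D|]normrM (ger0_norm c0) in h3.
  have -> : `|(c * D) ^+ 2 / 2| = c ^+ 2 * `|D| ^+ 2 / 2.
    rewrite real_normK ?num_real// -exprMn ger0_norm// divr_ge0//.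
    exact: sqr_ge0.
  have := D3 0%N isT; have := D3 1%N isT; have := D3 2%N isT.
  rewrite expr0 expr1 => d2 d1 d0.
  have := ler_wpM2l c0 d1; have := ler_wpM2l (sqr_ge0 c) d2.
  have : 0 <= c ^+ 2 * `|D| ^+ 2 by rewrite mulr_ge0 ?sqr_ge0 ?exprn_ge0.
  by nra.
have D31 : 1 <= `|D| ^+ 3 by rewrite exprn_ege1// ltW.
rewrite -[X in _ <= X * _]addrA [leRHS]mulrDl; apply: ler_wpDl.
  by rewrite !mulr_ge0 ?expR_ge0// exprn_ge0.
rewrite [leRHS]mulrDl lerD//.
  by rewrite (le_trans h1)// ler_peMr// expR_ge0.
by rewrite -[leRHS]mulrA ler_pM ?expR_ge0.
Qed.

Definition euler_step {R : realType} (c h y w : R) : R :=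
  y * lognormal h w / (1 + c / 2 * y * h).

(** From [e^(-x) >= 1 - x] follows [e^x <= 1 / (1 - x)], which lies below the polynomial for
    [x <= 1 / 2]. *)
Lemma expR_le_quadratic (R : realType) (x : R) : 0 <= x <= 1 / 2 ->
  expR x <= 1 + x + 2 * x ^+ 2.
Proof.
move=> /andP[x0 x1].
have x2 : 0 < 1 - x by lra.
have : expR x <= (1 - x)^-1.
  by rewrite -[expR x]invrK lef_pV2 ?posrE ?invr_gt0 ?expR_gt0// -expRN expR_ge1Dx.
move=> /le_trans; apply; rewrite -div1r ler_pdivrMr//; nra.
Qed.

Section euler_step_estimate.
Context {R : realType}.
Variables c K : R.
Hypotheses (c0 : 0 <= c) (K0 : 0 <= K).
Let A := c / 2 * K.

Let A0 : 0 <= A. Proof. by rewrite mulr_ge0// divr_ge0. Qed.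

Section fixed_step.
Variables h y : R.
Hypotheses (h0 : 0 < h) (hS : h <= 1 / 12) (yK : 0 <= y <= K).
Let a := c / 2 * y.
Let k := (1 + a * h)^-1.
Let r := Num.sqrt h.
Local Notation nu := (normal_prob 0 r).

Let a0 : 0 <= a. Proof. by case/andP: yK => *; rewrite mulr_ge0// divr_ge0. Qed.

Let aA : a <= A.
Proof. by case/andP: yK => *; rewrite ler_wpM2l// divr_ge0. Qed.

Let ah1 : 0 < 1 + a * h. Proof. by rewrite ltr_pwDl// mulr_ge0// ltW. Qed.

Let k0 : 0 < k. Proof. by rewrite invr_gt0. Qed.

Let k1 : 1 - k = a * h * k.
Proof. by rewrite /k; field; rewrite gt_eqF. Qed.

Let kle1 : k <= 1.
Proof. by rewrite -subr_ge0 k1 (mulr_ge0 (mulr_ge0 a0 (ltW h0)) (ltW k0)). Qed.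

Let k1A : 1 - k <= A * h.
Proof.
have ah0 := mulr_ge0 a0 (ltW h0).
by rewrite k1 (le_trans (ler_piMr ah0 kle1))// (ler_wpM2r (ltW h0) aA).
Qed.

Let sqD (u v : R) : (u - v) ^+ 2 <= 2 * (u ^+ 2 + v ^+ 2).
Proof.
rewrite -subr_ge0 (_ : _ - _ = (u + v) ^+ 2); last by ring.
exact: sqr_ge0.
Qed.

Let increment_sq x : (y * x * k - y) ^+ 2
  <= 2 * K ^+ 2 * ((x - 1) ^+ 2 + (A * h) ^+ 2).
Proof.
case/andP: yK => y0 yleK.
(* Separates the centred noise [x - 1] from the drift [1 - k] caused by the denominator. *)
have -> : y * x * k - y = y * (k * (x - 1) - (1 - k)) by ring.
rewrite exprMn [leRHS](_ : _ = K ^+ 2 *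
  (2 * ((x - 1) ^+ 2 + (A * h) ^+ 2))); last by ring.
apply: ler_pM; [exact: sqr_ge0|exact: sqr_ge0|by rewrite lerXn2r// nnegrE|].
rewrite (le_trans (sqD _ _))// ler_wpM2l// lerD//.
  by rewrite exprMn ler_piMl ?sqr_ge0// exprn_ile1// ltW.
by rewrite lerXn2r// nnegrE ?subr_ge0// (le_trans _ k1A)// subr_ge0.
Qed.

Let increment_quart x : (y * x * k - y) ^+ 4
  <= 8 * K ^+ 4 * ((x - 1) ^+ 4 + (A * h) ^+ 4).
Proof.
have := increment_sq x; set D := _ - y; set U := (x - 1); set V := A * h => D2.
rewrite (_ : D ^+ 4 = (D ^+ 2) ^+ 2); last by ring.
apply: (@le_trans _ _ ((2 * K ^+ 2 * (U ^+ 2 + V ^+ 2)) ^+ 2)).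
  by rewrite lerXn2r// nnegrE ?sqr_ge0// (le_trans _ D2)// sqr_ge0.
(* The sum is written as a difference so that [sqD] applies to [U ^+ 2] and [- V ^+ 2]. *)
rewrite [leLHS](_ : _ = 4 * (K ^+ 2) ^+ 2 * (U ^+ 2 - (- V ^+ 2)) ^+ 2); last by ring.
rewrite [leRHS](_ : _ =
  4 * (K ^+ 2) ^+ 2 * (2 * ((U ^+ 2) ^+ 2 + (- V ^+ 2) ^+ 2))); last by ring.
by apply: ler_wpM2l; [rewrite mulr_ge0// sqr_ge0|exact: sqD].
Qed.

Variable C : R.
Hypotheses (C0 : 0 <= C) (taylor : forall y D : R, 0 <= y <= K ->
  `|truncexp c K (y + D) - expR (c * y) * (1 + c * D + (c * D) ^+ 2 / 2)|
    <= C * `|D| ^+ 3).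

Let r0 : 0 < r. Proof. by rewrite sqrtr_gt0. Qed.
Let r2 : r ^+ 2 = h. Proof. by rewrite sqr_sqrtr// ltW. Qed.

Let B2 := C * r * (2 * K ^+ 2).
Let B4 := C / r * (8 * K ^+ 4).
Let E := expR (c * y).

(* The quadratic Taylor polynomial at [y], expanded in [x], and a bound on the
   error: [|D|^3 <= r D^2 + D^4 / r] leaves only even moments. *)
Let main x := quartic (E * (1 - c * y + (c * y) ^+ 2 / 2))
  (E * (c * y * k - (c * y) ^+ 2 * k)) (E * ((c * y * k) ^+ 2 / 2)) 0 0 x.

Let remainder x := quartic (B2 * (1 + (A * h) ^+ 2) + B4 * (1 + (A * h) ^+ 4))
  (- (2 * B2 + 4 * B4)) (B2 + 6 * B4) (- (4 * B4)) B4 x.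

Let pointwise w :
  `|truncexp c K (euler_step c h y w) - main (lognormal h w)|
  <= remainder (lognormal h w).
Proof.
set x := lognormal h w; set D := y * x * k - y.
have -> : euler_step c h y w = y + D by rewrite /D subrKC.
have -> : main x = E * (1 + c * D + (c * D) ^+ 2 / 2).
  by rewrite /main /quartic /D; field.
have -> : remainder x = C * (r * (2 * K ^+ 2 * ((x - 1) ^+ 2 + (A * h) ^+ 2))
    + (8 * K ^+ 4 * ((x - 1) ^+ 4 + (A * h) ^+ 4)) / r).
  by rewrite /remainder /quartic /B2 /B4; ring.
rewrite (le_trans (taylor _ _ yK))// ler_wpM2l//.
apply: (@le_trans _ _ (r * D ^+ 2 + D ^+ 4 / r)); last first.
  apply: lerD; first by rewrite ler_wpM2l ?(ltW r0)//; exact: increment_sq.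
  by rewrite ler_wpM2r ?invr_ge0 ?(ltW r0)//; exact: increment_quart.
rewrite -(ler_pM2r r0) mulrDl divfK ?gt_eqF//.
rewrite -[D ^+ 2]real_normK ?num_real// (_ : D ^+ 4 = (D ^+ 2) ^+ 2); last by ring.
rewrite -[D ^+ 2]real_normK ?num_real//; move: `|D| => u.
rewrite -subr_ge0 (_ : _ - _
  = u ^+ 2 * ((u - r / 2) ^+ 2 + 3 / 4 * r ^+ 2)); last by field.
by rewrite mulr_ge0 ?sqr_ge0// addr_ge0 ?sqr_ge0// mulr_ge0 ?sqr_ge0.
Qed.

Let e1 : expR h <= 1 + h + 2 * h ^+ 2.
Proof.
have := h0; have := hS => *.
by apply: expR_le_quadratic; apply/andP; split; lra.
Qed.

(** The squared increment has mean of order [h] and its fourth power has mean of order [h^2], so the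
    weights [r] and [1 / r] with [r = sqrt h] make both contributions of order [h r]. *)
Let remainder_le : \int[nu]_w (remainder (lognormal h w))
  <= C * (2 * K ^+ 2 * (2 + A ^+ 2) + 8 * K ^+ 4 * (84 + A ^+ 4)) * (h * r).
Proof.
rewrite Rintegral_lognormal_quartic//.
have hp := h0; have hs := hS; have e1h := e1.
have e3 := expR_ge1Dx (3 * h).
(* The hypothesis [h <= 1 / 12] places [6 * h] in the range of [expR_le_quadratic]. *)
have e6 : expR (6 * h) <= 1 + 6 * h + 2 * (6 * h) ^+ 2.
  by apply: expR_le_quadratic; apply/andP; split; lra.
have hh : h ^+ 2 <= h / 12 by rewrite expr2; nra.
have B20 : 0 <= B2 by rewrite !mulr_ge0 ?sqr_ge0// ltW.
have B40 : 0 <= B4 by rewrite !mulr_ge0 ?exprn_ge0// invr_ge0 ltW.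
have m2 : B2 * (expR h - 1 + (A * h) ^+ 2) <= B2 * (h * (2 + A ^+ 2)).
  rewrite ler_wpM2l// mulrDr lerD//; first by lra.
  rewrite exprMn mulrC ler_wpM2r ?sqr_ge0//; lra.
(* In the fourth central moment the terms of order 0 and 1 in [h] cancel; 84 is 72 from [e^(6h)]
   plus 12 from [6 e^h]. *)
have m4 : B4 * (expR (6 * h) - 4 * expR (3 * h) + 6 * expR h - 3 + (A * h) ^+ 4)
    <= B4 * (h ^+ 2 * (84 + A ^+ 4)).
  rewrite ler_wpM2l// mulrDr lerD//; first by lra.
  rewrite exprMn mulrC ler_wpM2r ?exprn_ge0//.
  rewrite (_ : h ^+ 4 = h ^+ 2 * h ^+ 2); last by ring.
  by rewrite ler_piMl ?sqr_ge0//; lra.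
have -> : C * (2 * K ^+ 2 * (2 + A ^+ 2) + 8 * K ^+ 4 * (84 + A ^+ 4)) * (h * r)
  = B2 * (h * (2 + A ^+ 2)) + B4 * (h ^+ 2 * (84 + A ^+ 4)).
  by rewrite /B2 /B4 -r2; field; rewrite gt_eqF.
lra.
Qed.

(** By [k1] the drift [c y (1 - k)] equals [(c y)^2 h k / 2], which offsets the leading part
    [(c y)^2 h k^2 / 2] of the second-order term. The three terms left are each of order [h^2], and
    [h^2 <= h r] because [h <= 1]. *)
Let main_near : `|\int[nu]_w (main (lognormal h w)) - E|
  <= expR (c * K) * ((c * K) ^+ 2 / 2) * (2 + A + A ^+ 2) * (h * r).
Proof.
case/andP: yK => y0 yleK.
rewrite Rintegral_lognormal_quartic//.
have -> : E * (1 - c * y + (c * y) ^+ 2 / 2)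
    + E * (c * y * k - (c * y) ^+ 2 * k) + E * ((c * y * k) ^+ 2 / 2) * expR h
    + 0 * expR (3 * h) + 0 * expR (6 * h) - E
  = E * ((c * y) ^+ 2 / 2) * (k ^+ 2 * (expR h - 1 - h)
     - h * k * (1 - k) + (1 - k) ^+ 2).
  rewrite (_ : h * k * (1 - k) = h * k - h * k ^+ 2); last by ring.
  apply/eqP; rewrite -subr_eq0 [X in X == _](_ : _ =
    E * (c * y) * ((1 - k) * -1 + c / 2 * y * h * k)); last by field.
  by rewrite -/a -k1; apply/eqP; ring.
rewrite normrM ger0_norm; last first.
  by rewrite mulr_ge0 ?expR_ge0// divr_ge0// sqr_ge0.
rewrite -[leRHS]mulrA; apply: ler_pM => //.
- by rewrite mulr_ge0 ?expR_ge0// divr_ge0// sqr_ge0.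
- have cyK := ler_wpM2l c0 yleK.
  apply: ler_pM; rewrite ?expR_ge0 ?ler_expR ?divr_ge0 ?sqr_ge0//.
  by rewrite ler_wpM2r ?invr_ge0// lerXn2r// nnegrE mulr_ge0.
have [hp hs e1h] := And3 h0 hS e1; have [k0' kl k1l] := And3 k0 kle1 k1A.
have e0 := expR_ge1Dx h.
have hhr : h ^+ 2 <= h * r.
  rewrite expr2 ler_wpM2l ?(ltW h0)// -r2 expr2 ler_piMr ?(ltW r0)//.
  by rewrite -[leRHS]sqrtr1 ler_wsqrtr//; lra.
have f1 : `|k ^+ 2 * (expR h - 1 - h)| <= 2 * h ^+ 2.
  rewrite ger0_norm; last by rewrite mulr_ge0 ?sqr_ge0//; lra.
  apply: (@le_trans _ _ (1 * (expR h - 1 - h))); last by lra.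
  by rewrite ler_wpM2r ?exprn_ile1 ?(ltW k0)//; lra.
have u0 : 0 <= 1 - k by lra.
have f2 : `|h * k * (1 - k)| <= h ^+ 2 * A.
  rewrite ger0_norm ?mulr_ge0 ?(ltW h0) ?(ltW k0)// expr2 -!mulrA.
  rewrite ler_wpM2l ?(ltW h0)// [h * A]mulrC -[leRHS]mul1r.
  by rewrite ler_pM ?(ltW k0).
have f3 : `|(1 - k) ^+ 2| <= h ^+ 2 * A ^+ 2.
  by rewrite ger0_norm ?sqr_ge0// mulrC -exprMn lerXn2r// nnegrE (le_trans u0).
rewrite (le_trans (ler_normD _ _))//.
have f4 := ler_normB (k ^+ 2 * (expR h - 1 - h)) (h * k * (1 - k)).
apply: (@le_trans _ _ (h ^+ 2 * (2 + A + A ^+ 2))); first by lra.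
by rewrite mulrC ler_wpM2l// !addr_ge0// sqr_ge0.
Qed.

Let measurable_step : measurable_fun setT (fun w => truncexp c K (euler_step c h y w)).
Proof.
apply: (measurableT_comp (measurable_truncexp R c K)).
apply: measurable_funM => //; apply: measurable_funM => //.
exact: measurable_lognormal.
Qed.

Let integrable_step :
  nu.-integrable setT (EFin \o (fun w => truncexp c K (euler_step c h y w))).
Proof.
apply: (integrable_of_bounded _ _ _ _ _ (expR (c * (K + 1)))).
  exact: measurable_step.
by move=> w; rewrite ger0_norm ?expR_ge0//; exact: truncexp_le.
Qed.

Lemma euler_step_near :
  `|\int[nu]_w (truncexp c K (euler_step c h y w)) - truncexp c K y|
  <= (C * (2 * K ^+ 2 * (2 + A ^+ 2) + 8 * K ^+ 4 * (84 + A ^+ 4))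
      + expR (c * K) * ((c * K) ^+ 2 / 2) * (2 + A + A ^+ 2)) * (h * r).
Proof.
have imain : nu.-integrable setT (EFin \o (fun w => main (lognormal h w))).
  exact: integrable_lognormal_quartic.
have idiff : nu.-integrable setT (EFin \o (fun w =>
    truncexp c K (euler_step c h y w) - main (lognormal h w))).
  by have := integrableB measurableT integrable_step imain.
rewrite [truncexp c K y]truncexpE; last first.
  by case/andP: yK => _ /le_trans; apply; rewrite lerDl.
rewrite mulrDl (le_trans _ (lerD remainder_le main_near))//.
rewrite -/E (le_trans (ler_distD (\int[nu]_w main (lognormal h w)) _ _))// lerD2r.
rewrite -RintegralB// (le_trans (le_normr_Rintegral _ idiff))//.
apply: le_Rintegral => //.
- by have := integrable_norm idiff.
- exact: integrable_lognormal_quartic.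
Qed.

End fixed_step.
End euler_step_estimate.

Lemma euler_step_estimate (R : realType) (c K : R) : 0 <= c -> 0 <= K ->
  exists2 C, 0 <= C & forall h y : R, 0 < h -> h <= 1 / 12 -> 0 <= y <= K ->
    `|\int[normal_prob 0 (Num.sqrt h)]_w truncexp c K (euler_step c h y w)
      - truncexp c K y| <= C * (h * Num.sqrt h).
Proof.
move=> c0 K0; have [C C0 taylor] := truncexp_taylor2 R c K c0 K0.
eexists; last first.
  by move=> h y h0 hS yK; exact: (euler_step_near c K c0 K0 h y h0 hS yK C C0 taylor).
have A0 : 0 <= c / 2 * K by rewrite mulr_ge0// divr_ge0.
move: A0; set A := c / 2 * K => A0.
by do ?[exact: sqr_ge0|exact: expR_ge0|exact: exprn_ge0|done|apply: addr_ge0|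
        apply: mulr_ge0|rewrite invr_ge0].
Qed.

(** * Brownian increments *)

Lemma measurable_fun_invr d (T : measurableType d) (R : realType) (f : T -> R) :
  (forall x, 0 < f x) -> measurable_fun setT f ->
  measurable_fun setT (fun x => (f x)^-1).
Proof.
move=> f0 mf; rewrite (_ : (fun _ => _) = fun x => expR (- ln (f x))).
  by do 2!apply: measurableT_comp => //; exact: measurableT_comp mf.
by apply/funext => x; rewrite expRN lnK// posrE.
Qed.

Section measurable_wrt_theory.
Context d (Omega : measurableType d) (R : realType) (G : set (set Omega)).
Hypothesis sG : sigma_algebra setT G.

(** Passing to the measurable type generated by [G] makes the closure properties of [measurable_fun]
    available for measurability with respect to the filtration. *)
Lemma measurable_wrtP (Y : Omega -> R) : measurable_wrt G Y <->
  measurable_fun setT (Y : g_sigma_algebraType G -> R).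
Proof.
have GE := measurable_g_measurableTypeE sG.
split=> [mY _ D mD|mY D mD]; first by rewrite setTI GE; exact: mY.
by rewrite -GE -[_ @^-1` _]setTI; exact: mY.
Qed.

Lemma measurable_wrt_fun (Y : Omega -> R) : G `<=` measurable ->
  measurable_wrt G Y -> measurable_fun setT Y.
Proof. by move=> GS mY _ D mD; rewrite setTI; exact/GS/mY. Qed.

End measurable_wrt_theory.

Section brownian_increment.
Context d (Omega : measurableType d) (R : realType) (P : probability Omega R).
Variables (F : R -> set (set Omega)) (B : R -> Omega -> R).
Hypotheses (filF : is_filtration F) (BM : standard_brownian_motion P F B).

Lemma filtration_sigma t : 0 <= t -> sigma_algebra setT (F t).
Proof. by case: filF => + _ _; exact. Qed.

Lemma filtration_sub t : 0 <= t -> F t `<=` measurable.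
Proof. by case: filF => _ + _; exact. Qed.

Lemma measurable_brownian t : 0 <= t -> measurable_fun setT (B t).
Proof.
move=> t0; apply: (measurable_wrt_fun _ _ _ _ _ (filtration_sub t t0)).
by case: BM => + _ _ _ _; exact.
Qed.

Lemma measurable_increment s t : 0 <= s -> 0 <= t ->
  measurable_fun setT (fun w => B t w - B s w).
Proof. by move=> s0 t0; apply: measurable_funB; exact: measurable_brownian. Qed.

Lemma increment_integral (Y : Omega -> R) (f : R * R -> R) s t :
  0 <= s -> s < t -> measurable_wrt (F s) Y ->
  (forall z, 0 <= f z) -> measurable_fun setT f ->
  (\int[P]_w (f (Y w, B t w - B s w))%:E
   = \int[P]_w \int[normal_prob 0 (Num.sqrt (t - s))]_x (f (Y w, x))%:E)%E.
Proof.
move=> s0 st mY f0 mf.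
case: BM => _ _ _ ind law.
apply: (independent_integral _ _ _ _ _ (measurableTypeR R)) => //.
- exact: (measurable_wrt_fun _ _ _ _ _ (filtration_sub s s0)).
- by apply: measurable_increment => //; exact: le_trans (ltW st).
- move=> A D mA mD; rewrite ind//; last exact: mY.
  by congr (_ * _)%E; exact: law.
Qed.

(** Independence reduces the mean over the increment to [euler_step_estimate] at each value of [Z].
    The constant is uniform in [Z], [s] and [t], so that errors can be summed over a grid. *)
Lemma brownian_step (c K : R) : 0 <= c -> 0 <= K ->
  exists2 C, 0 <= C & forall (Z : Omega -> R) (s t : R),
    0 <= s -> s < t -> t - s <= 1 / 12 ->
    measurable_wrt (F s) Z -> (forall w, 0 <= Z w <= K) ->
    `|\int[P]_w (truncexp c K (euler_step c (t - s) (Z w) (B t w - B s w))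
                 - truncexp c K (Z w))| <= C * ((t - s) * Num.sqrt (t - s)).
Proof.
move=> c0 K0; have [C C0 est] := euler_step_estimate R c K c0 K0.
exists C => // Z s t s0 st; set h := t - s => hS mZ ZK.
have h0 : 0 < h by rewrite subr_gt0.
pose N : probability _ R := normal_prob 0 (Num.sqrt h).
(* [Num.max 0] keeps the denominator positive for every [z], which makes [f] measurable on the whole
   plane; it does not alter the values taken by [Z]. *)
pose f (z : R * R) := truncexp c K (euler_step c h (Num.max 0 z.1) z.2).
have mf : measurable_fun setT f.
  apply: (measurableT_comp (measurable_truncexp R c K)).
  apply: measurable_funM.
    apply: measurable_funM; first exact: measurable_maxr.
    apply: (measurableT_comp (measurable_lognormal _)) => //.
  apply: measurable_fun_invr.
    move=> z; rewrite ltr_pwDl// !mulr_ge0 ?(ltW h0)// ?le_max ?lexx//.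
  apply: measurable_funD => //; apply: measurable_funM => //.
  by apply: measurable_funM => //; exact: measurable_maxr.
have mZ' := measurable_wrt_fun _ _ _ _ _ (filtration_sub s s0) mZ.
have mB : measurable_fun setT (fun w => B t w - B s w).
  by apply: measurable_increment => //; exact: le_trans (ltW st).
have Z0 w : Num.max 0 (Z w) = Z w by rewrite max_r//; case/andP: (ZK w).
pose M := expR (c * (K + 1)).
have fM z : `|f z| <= M by rewrite ger0_norm ?expR_ge0// truncexp_le.
have fZ w x : f (Z w, x) = truncexp c K (euler_step c h (Z w) x).
  by rewrite /f Z0.
pose g w := \int[N]_x f (Z w, x).
have intf w : N.-integrable setT (EFin \o (fun x => f (Z w, x))).
  apply: (integrable_of_bounded _ _ _ _ _ M) => //.
  exact: (measurableT_comp mf (pair1_measurable _)).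
have gE w : (\int[N]_x (f (Z w, x))%:E = (g w)%:E)%E.
  by rewrite /g /Rintegral fineK//; exact: integrable_fin_num (intf w).
have mg : measurable_fun setT g.
  apply/measurable_EFinP.
  rewrite (_ : _ \o _ = fubini_F N (EFin \o f) \o Z).
    apply: measurableT_comp => //; apply: measurable_fun_fubini_tonelli_F.
      exact/measurable_EFinP.
    by move=> z; rewrite lee_fin expR_ge0.
  by apply/funext => w /=; rewrite -gE.
have near w : `|g w - truncexp c K (Z w)| <= C * (h * Num.sqrt h).
  have -> : g w = \int[normal_prob 0 (Num.sqrt h)]_x
      truncexp c K (euler_step c h (Z w) x).
    by apply: eq_Rintegral => x _; rewrite fZ.
  exact: est.
have mV : measurable_fun setT (fun w => truncexp c K (Z w)).
  exact: (measurableT_comp (measurable_truncexp R c K)).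
have mU : measurable_fun setT (fun w => f (Z w, B t w - B s w)).
  by apply: (measurableT_comp mf); exact: measurable_fun_pair.
have intg : P.-integrable setT (EFin \o (fun w => g w - truncexp c K (Z w))).
  by apply: integrable_of_bounded near; exact: measurable_funB.
have intV : P.-integrable setT (EFin \o (fun w => truncexp c K (Z w))).
  apply: (integrable_of_bounded _ _ _ _ _ M) => // w.
  by rewrite ger0_norm ?expR_ge0// truncexp_le.
have intU : P.-integrable setT (EFin \o (fun w => f (Z w, B t w - B s w))).
  exact: (integrable_of_bounded _ _ _ _ _ M).
under eq_Rintegral do rewrite -fZ.
rewrite RintegralB// (_ : \int[P]_w f _ = \int[P]_w g w); last first.
  rewrite /Rintegral increment_integral//; last by move=> z; exact: expR_ge0.
  by congr fine; apply: eq_integral => w _; exact: gE.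
have intg' : P.-integrable setT (EFin \o g).
  have := integrableD measurableT intg intV; apply: eq_integrable => // w _ /=.
  by rewrite -EFinD subrK.
rewrite -RintegralB// (le_trans (le_normr_Rintegral _ intg))//.
apply: (@le_trans _ _ (\int[P]_w (C * (h * Num.sqrt h)))).
  apply: le_Rintegral => //.
  - by have := integrable_norm intg.
  - exact: finite_measure_integrable_cst.
rewrite Rintegral_cst// [X in fine X](_ : _ = 1%E) ?mulr1//.
exact: probability_setT.
Qed.

End brownian_increment.

(** * Riemann sums *)

Section integral_of_continuous.
Context {R : realType}.
Implicit Types (m : R -> R) (a b s t e : R).
Local Notation primitive m := (fun t => \int[lebesgue_measure]_(x in `[0, t]) m x).

Lemma integrable_continuous_itv m a b : continuous m ->
  lebesgue_measure.-integrable `[a, b] (EFin \o m).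
Proof.
move=> cm; apply: continuous_compact_integrable; first exact: segment_compact.
exact: continuous_subspaceT.
Qed.

Lemma primitive_increment m a b lo hi : continuous m -> 0 <= a -> a <= b ->
  (forall x, a <= x <= b -> lo <= m x <= hi) ->
  lo * (b - a) <= primitive m b - primitive m a <= hi * (b - a).
Proof.
move=> cm a0 ab mab.
rewrite Rintegral_itvB ?bnd_simp//; last exact: integrable_continuous_itv.
have sub (f : R -> R) : continuous f ->
    lebesgue_measure.-integrable `]a, b] (EFin \o f).
  move=> cf; have := integrable_continuous_itv f a b cf.
  by apply: integrableS => //; exact: subset_itv_oc_cc.
have int := sub m cm.
have icst k : lebesgue_measure.-integrable `]a, b] (EFin \o (fun=> k)).
  by apply: sub => x; exact: cvg_cst.
have E k : k * (b - a) = \int[lebesgue_measure]_(x in `]a, b]) k.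
  rewrite Rintegral_cst// [X in fine X](_ : _ = (b - a)%:E)//.
  apply: etrans (lebesgue_measure_itv (Interval (BRight a) (BRight b))) _ => /=.
  rewrite lte_fin; move: ab; rewrite le_eqVlt => /predU1P[->|->].
    by rewrite ltxx subrr.
  by rewrite -EFinD.
rewrite !E; apply/andP; split; apply: le_Rintegral => // x /=;
  by rewrite in_itv/= => /andP[ax xb];
     have := mab x; rewrite (ltW ax) xb => /(_ isT)/andP[].
Qed.

(** Admissible radii run along the filter [0^'+], and the near-covering form of compactness makes
    one of them work for all points. *)
Lemma uniformly_continuous_itv m a b e : continuous m -> 0 < e ->
  exists2 r, 0 < r & forall x y, a <= x <= b -> a <= y <= b ->
    `|x - y| <= r -> `|m x - m y| <= e.
Proof.
move=> cm e0.
have := @segment_compact R a b; rewrite compact_near_coveringP.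
move=> /(_ R 0^'+ (fun r x => forall y, `|x - y| <= r -> `|m x - m y| <= e)).
move=> cov; have [x _|r /= r0 br] := cov _ _.
  have := cm x => /cvgr_dist_le /(_ (e / 2)).
  rewrite divr_gt0// => /(_ isT) /nbhs_normP[r /= r0 br].
  exists (ball x (r / 2), [set d | d <= r / 2]) => /=.
    split; first by apply: nbhsx_ballx; rewrite divr_gt0.
    by apply: nbhs_right_le; rewrite divr_gt0.
  move=> [x' d] /= [xx' dr] y x'y.
  have h1 : `|m x - m x'| <= e / 2.
    by apply: br => /=; rewrite (lt_trans xx')// ltr_pdivrMr// ltr_pMr// ltr1n.
  have h2 : `|m x - m y| <= e / 2.
    apply: br => /=.
    rewrite (le_lt_trans (ler_distD x' _ _))// (splitr r) ltr_leD//.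
    exact: le_trans dr.
  rewrite (le_trans (ler_distD (m x) _ _))// (splitr e) lerD//.
  by rewrite distrC.
exists (r / 2); first by rewrite divr_gt0.
move=> x y axb ayb xy; apply: (br (r / 2)) => //=.
- by rewrite sub0r normrN gtr0_norm ?divr_gt0// ltr_pdivrMr// ltr_pMr// ltr1n.
- by rewrite divr_gt0.
Qed.

(** Uniformity in the number [k] of summands matters because the sum will be cut at an index
    depending on [n] and on the path. *)
Lemma riemann_sum_cvg m s t e : continuous m -> 0 <= s -> s <= t -> 0 < e ->
  \forall n \near \oo, forall k, (k <= n.+1)%N ->
    `|\sum_(j < k) m (s + j%:R * ((t - s) / n.+1%:R)) * ((t - s) / n.+1%:R)
      - (primitive m (s + k%:R * ((t - s) / n.+1%:R)) - primitive m s)| <= e.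
Proof.
(* The [+ 1] covers [s = t]. Each cell contributes an error of at most [e' h], and the cells have
   total length at most [t - s]. *)
move=> cm s0 st e0; pose e' := e / (t - s + 1).
have ts1 : 0 < t - s + 1 by rewrite ltr_pwDr// subr_ge0.
have e'0 : 0 < e' by rewrite divr_gt0.
have [r r0 unif] := uniformly_continuous_itv m s t e' cm e'0.
have small : \forall n \near \oo, (t - s) / n.+1%:R <= r.
  near=> n; rewrite ler_pdivrMr// mulrC -ler_pdivrMr//.
  rewrite ltW// (lt_trans (truncnS_gt _))// ltr_nat ltnS.
  by near: n; exact: nbhs_infty_gt.
near=> n => k kn; set h := (t - s) / n.+1%:R.
have hr : h <= r by rewrite /h; near: n.
have h0 : 0 <= h by rewrite divr_ge0// subr_ge0.
have grid j : (j <= n.+1)%N -> s <= s + j%:R * h <= t.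
  move=> jn; rewrite lerDl mulr_ge0//= -lerBrDl /h mulrCA.
  by rewrite ler_piMr ?subr_ge0// ler_pdivrMr// mul1r ler_nat.
apply: (@le_trans _ _ (k%:R * h * e')); last first.
  have /andP[_] := grid k kn; rewrite -lerBrDl => kh.
  rewrite (le_trans (ler_wpM2r (ltW e'0) kh))// /e' mulrCA ler_piMr ?(ltW e0)//.
  by rewrite ler_pdivrMr// mul1r lerDl.
elim: k kn => [|k IH] kn.
  by rewrite big_ord0 !mul0r addr0 subrr subrr normr0.
have /andP[sk kt] := grid k (ltnW kn); have /andP[_ k1t] := grid _ kn.
rewrite big_ord_recr /=; set S := \sum_(_ < _) _ in IH *.
set tk := s + k%:R * h in IH sk kt *.
have tk1 : s + k.+1%:R * h = tk + h by rewrite /tk -natr1; ring.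
rewrite tk1 in k1t *.
have /andP[lo hi] : (m tk - e') * (tk + h - tk) <= primitive m (tk + h) - primitive m tk
    <= (m tk + e') * (tk + h - tk).
  apply: primitive_increment => //; first exact: le_trans sk.
    by rewrite lerDl.
  move=> x /andP[tkx xtk]; rewrite -ler_distl; apply: unif.
  - by rewrite (le_trans sk)// (le_trans xtk).
  - by rewrite sk kt.
  - by rewrite ger0_norm ?subr_ge0// lerBlDl (le_trans xtk)// lerD2l.
have := IH (ltnW kn).
rewrite !ler_distl -natr1 => /andP[I1 I2]; apply/andP; split.
  move: lo hi I1 I2; rewrite -/h.
  by move: (primitive m _) (primitive m _) (primitive m _) => p q u; nra.
move: lo hi I1 I2; rewrite -/h.
by move: (primitive m _) (primitive m _) (primitive m _) => p q u; nra.
Unshelve. all: by end_near.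
Qed.

End integral_of_continuous.

(** * The scheme along a grid *)

(** [nu] is the first index at which [alive] fails, or [n] if there is none. *)
Lemma telescope_until (V : zmodType) (alive : nat -> bool) (f : nat -> V) (n : nat) :
  (forall j, alive j.+1 -> alive j) ->
  exists nu, [/\ (nu <= n)%N, forall j, (j < nu)%N -> alive j,
    (nu < n)%N -> ~~ alive nu
    & \sum_(j < n) (if alive j then f j.+1 - f j else 0) = f nu - f 0%N].
Proof.
move=> mono; elim: n => [|n [nu [nun live dead sumE]]].
  by exists 0%N; split => //; rewrite big_ord0 subrr.
have [nuE|ltnu] := eqVneq nu n; last first.
  have {}ltnu : (nu < n)%N by rewrite ltn_neqAle ltnu.
  exists nu; split => //; [exact: leqW|by move=> _; exact: dead|].
  rewrite big_ord_recr/= sumE ifN ?addr0//.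
  apply: contraNN (dead ltnu) => an.
  rewrite -(subnKC (ltnW ltnu)) in an.
  by elim: (n - nu)%N an => [|k IH]; rewrite ?addn0// addnS => /mono.
have [an|an] := boolP (alive n).
  exists n.+1; split => //; last first.
    by rewrite big_ord_recr/= an sumE nuE addrC addrA subrK.
  - by rewrite ltnn.
  - by move=> j; rewrite ltnS leq_eqVlt => /predU1P[->//|]; rewrite -nuE => /live.
exists nu; split => //; [exact: leqW|by rewrite nuE|].
by rewrite big_ord_recr/= (negbTE an) addr0.
Qed.

Definition grid {R : realType} (s t : R) (n j : nat) : R :=
  s + j%:R * ((t - s) / n.+1%:R).

Section grid.
Context {R : realType}.
Variables (s t : R) (n : nat).
Hypothesis st : s <= t.

Lemma mesh_ge0 : 0 <= (t - s) / n.+1%:R.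
Proof. by rewrite divr_ge0// subr_ge0. Qed.

Lemma grid0 : grid s t n 0 = s. Proof. by rewrite /grid mul0r addr0. Qed.

Lemma gridS j : grid s t n j.+1 = grid s t n j + (t - s) / n.+1%:R.
Proof. by rewrite /grid -natr1 mulrDl mul1r addrA. Qed.

Lemma grid_end : grid s t n n.+1 = t.
Proof. by rewrite /grid mulrC divfK// subrKC. Qed.

Lemma le_grid : {homo grid s t n : i j / (i <= j)%N >-> i <= j}.
Proof. by move=> i j ij; rewrite lerD2l ler_wpM2r ?mesh_ge0// ler_nat. Qed.

Lemma grid_ge j : s <= grid s t n j. Proof. by rewrite -[leLHS]grid0 le_grid. Qed.

Lemma grid_le j : (j <= n.+1)%N -> grid s t n j <= t.
Proof. by move=> jn; rewrite -[leRHS]grid_end le_grid. Qed.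

End grid.

Lemma mesh_cvg0 (R : realType) (s t : R) : (t - s) / n.+1%:R @[n --> \oo] --> (0 : R).
Proof.
by rewrite -[X in _ --> X](mulr0 (t - s)); apply: cvgMr; exact: cvg_harmonic.
Qed.

Definition bond_exponent {Omega : Type} {R : realType} (B : R -> Omega -> R)
    (c u : R) (w : Omega) : R :=
  2 * exp_mart B u w / (2 + exp_functional B u w * c).

Section euler_scheme.
Context {Omega : Type} {R : realType}.
Variables (B : R -> Omega -> R) (c s t : R) (n : nat).
Local Notation h := ((t - s) / n.+1%:R).

Definition euler_functional (k : nat) (w : Omega) : R :=
  exp_functional B s w + \sum_(j < k) exp_mart B (grid s t n j) w * h.

Definition euler_exponent (k : nat) (w : Omega) : R :=
  2 * exp_mart B (grid s t n k) w / (2 + euler_functional k w * c).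

Lemma exp_mart_gt0 u w : 0 < exp_mart B u w. Proof. exact: expR_gt0. Qed.

Lemma exp_functional_ge0 u w : 0 <= exp_functional B u w.
Proof. by apply: Rintegral_ge0 => x _; exact: expR_ge0. Qed.

Hypotheses (c0 : 0 <= c) (st : s <= t).

Lemma euler_functional_ge0 k w : 0 <= euler_functional k w.
Proof.
rewrite addr_ge0 ?exp_functional_ge0// sumr_ge0// => j _.
by rewrite mulr_ge0 ?(ltW (exp_mart_gt0 _ _))// mesh_ge0.
Qed.

Lemma euler_exponent_ge0 k w : 0 <= euler_exponent k w.
Proof.
rewrite divr_ge0 ?mulr_ge0 ?(ltW (exp_mart_gt0 _ _))// addr_ge0// mulr_ge0//.
exact: euler_functional_ge0.
Qed.

(** Since [c A >= 0], the denominator is at least 2. An upper bound on [B] thereby bounds the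
    exponent, which is what makes localization by the level of [B] work. *)
Lemma euler_exponent_le k w : euler_exponent k w <= exp_mart B (grid s t n k) w.
Proof.
have A0 := mulr_ge0 (euler_functional_ge0 k w) c0.
rewrite ler_pdivrMr ?ltr_pwDl// mulrC ler_wpM2l ?(ltW (exp_mart_gt0 _ _))//.
by rewrite lerDl.
Qed.

Lemma euler_exponent0 w : euler_exponent 0 w = bond_exponent B c s w.
Proof.
by rewrite /euler_exponent /euler_functional big_ord0 addr0 grid0.
Qed.

(** The new denominator [2 + c A + c M h] divided by the old one is [1 + (c / 2) y h] with
    [y = 2 M / (2 + c A)], so [M] and [A] enter only through [y]. *)
Lemma euler_exponentS k w : euler_exponent k.+1 w
  = euler_step c h (euler_exponent k w) (B (grid s t n k.+1) w - B (grid s t n k) w).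
Proof.
rewrite /euler_exponent /euler_step.
have -> : euler_functional k.+1 w
    = euler_functional k w + exp_mart B (grid s t n k) w * h.
  by rewrite /euler_functional big_ord_recr/= addrA.
have -> : exp_mart B (grid s t n k.+1) w = exp_mart B (grid s t n k) w
    * lognormal h (B (grid s t n k.+1) w - B (grid s t n k) w).
  by rewrite /exp_mart /lognormal -expRD gridS; congr expR; field.
have A0 := mulr_ge0 (euler_functional_ge0 k w) c0.
have M0 := exp_mart_gt0 (grid s t n k) w.
have h0 := mesh_ge0 s t n st.
set M := exp_mart _ _ _ in M0 *; set A := euler_functional k w in A0 *.
set x := lognormal _ _; set dt := (t - s) / n.+1%:R in h0 *.
have cMh := mulr_ge0 (mulr_ge0 c0 (ltW M0)) h0.
have d1 : 2 + A * c != 0 by rewrite gt_eqF// ltr_pwDl.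
have d2 : 2 + A * c + c * M * dt != 0 by rewrite gt_eqF// -addrA ltr_pwDl// addr_ge0.
move: d1 d2; move: M A x dt {A0 M0 h0 cMh} => M A x dt d1 d2; by field; rewrite d1 d2.
Qed.

End euler_scheme.

(** * Convergence of the scheme along continuous paths *)

Section continuous_paths.
Context {Omega : Type} {R : realType}.
Variable B : R -> Omega -> R.
Hypothesis cB : forall w, {within `[0, +oo[%classic, continuous (fun t => B t w)}.

(** Paths are unconstrained at negative times; freezing them there at their value at time 0 gives
    functions continuous on the whole line. *)
Definition extended_exp_mart (w : Omega) (u : R) : R := exp_mart B (Num.max 0 u) w.

Lemma continuous_extended_path w : continuous (fun u : R => B (Num.max 0 u) w).
Proof.
move=> x; have max0 u : (`[0, +oo[%classic : set R) (Num.max 0 u).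
  by rewrite /= in_itv/= le_max lexx.
have /subspace_continuousP/(_ _ (max0 x)) cBx := cB w.
have cmax : Num.max 0 u @[u --> x] --> Num.max 0 x.
  by apply: (@continuous_max R R (cst 0) id) => //; exact: cvg_cst.
move=> A hA; have {}hA : nbhs (Num.max 0 x : R)
    [set y : R | `[0, +oo[%classic y -> A (B y w)] := cBx A hA.
have : \forall u \near x, [set y : R | `[0, +oo[%classic y -> A (B y w)]
  (Num.max 0 u) := cmax _ hA.
by apply: filterS => u; exact.
Qed.

Lemma continuous_extended_exp_mart w : continuous (extended_exp_mart w).
Proof.
move=> x; apply: continuous_comp; last exact: continuous_expR.
apply: cvgB; first exact: continuous_extended_path.
apply: cvgMl.
by apply: (@continuous_max R R (cst 0) id) => //; exact: cvg_cst.
Qed.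

Lemma extended_exp_martE w u : 0 <= u -> extended_exp_mart w u = exp_mart B u w.
Proof. by move=> u0; rewrite /extended_exp_mart max_r. Qed.

Lemma exp_functionalE w t :
  exp_functional B t w = \int[lebesgue_measure]_(x in `[0, t]) extended_exp_mart w x.
Proof.
apply: eq_Rintegral => x; rewrite inE/= in_itv/= => /andP[x0 _].
by rewrite extended_exp_martE.
Qed.

Lemma exp_mart_bounded w t : exists2 C, 0 <= C &
  forall u, 0 <= u <= t -> exp_mart B u w <= C.
Proof.
have [t0|t0] := leP 0 t; last first.
  by exists 0 => // u /andP[u0 /(le_trans u0)]; rewrite leNgt t0.
have [x _ xmax] := EVT_max t0 (continuous_subspaceT (continuous_extended_exp_mart w)).
exists (extended_exp_mart w x) => [|u u0t]; first exact: expR_ge0.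
by rewrite -extended_exp_martE ?(andP u0t).1//; apply: xmax; rewrite in_itv.
Qed.

Lemma exp_functional_increment w a b lo hi : 0 <= a -> a <= b ->
  (forall x, a <= x <= b -> lo <= exp_mart B x w <= hi) ->
  lo * (b - a) <= exp_functional B b w - exp_functional B a w <= hi * (b - a).
Proof.
move=> a0 ab mab; rewrite !exp_functionalE.
apply: (primitive_increment (extended_exp_mart w)) => //.
  exact: continuous_extended_exp_mart.
move=> x axb; rewrite extended_exp_martE; first exact: mab.
by case/andP: axb => /(le_trans a0).
Qed.

Lemma exp_functional_lipschitz w t : exists2 C, 0 <= C &
  forall u v, 0 <= u <= t -> 0 <= v <= t ->
    `|exp_functional B u w - exp_functional B v w| <= C * `|u - v|.
Proof.
have [C C0 mC] := exp_mart_bounded w t; exists C => //.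
suff H u v : 0 <= u -> u <= v -> v <= t ->
    `|exp_functional B v w - exp_functional B u w| <= C * `|v - u|.
  move=> u v /andP[u0 ut] /andP[v0 vt]; have [uv|vu] := leP u v.
    by rewrite distrC (distrC u) H.
  by rewrite H// ltW.
move=> u0 uv vt; have := exp_functional_increment w u v 0 C u0 uv.
rewrite mul0r => /(_ _)/andP[].
  move=> x /andP[ux xv]; rewrite expR_ge0 mC//.
  by rewrite (le_trans u0 ux) (le_trans xv vt).
by move=> h1 h2; rewrite !ger0_norm// subr_ge0.
Qed.

Lemma exp_functional0 w : exp_functional B 0 w = 0.
Proof. by rewrite /exp_functional set_itv1 Rintegral_set1. Qed.

Section grid_limit.
Variables (s t r : R) (nu : nat -> nat) (w : Omega).
Hypotheses (s0 : 0 <= s) (st : s <= t) (srt : s <= r <= t).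
Hypotheses (nun : forall n, (nu n <= n.+1)%N)
  (near_r : forall n, `|grid s t n (nu n) - r| <= (t - s) / n.+1%:R).

Let r0 : 0 <= r. Proof. by case/andP: srt => /(le_trans s0). Qed.

Let x0t n : 0 <= grid s t n (nu n) <= t.
Proof. by rewrite (le_trans s0 (grid_ge _ _ _ st _))//= grid_le. Qed.

Let xr : grid s t n (nu n) @[n --> \oo] --> r.
Proof.
apply/cvgrPdist_le => e e0.
have /cvgrPdist_le/(_ _ e0) := mesh_cvg0 R s t.
apply: filterS => n; rewrite sub0r normrN ger0_norm ?mesh_ge0//.
by rewrite distrC; exact: le_trans.
Qed.

Lemma exp_mart_grid_cvg :
  exp_mart B (grid s t n (nu n)) w @[n --> \oo] --> exp_mart B r w.
Proof.
rewrite -extended_exp_martE//.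
rewrite (_ : (fun _ => _) = fun n => extended_exp_mart w (grid s t n (nu n))).
  exact: (continuous_cvg _ (continuous_extended_exp_mart w r) xr).
by apply/funext => n; rewrite extended_exp_martE//; case/andP: (x0t n).
Qed.

(** The error splits into that of the Riemann sum up to the grid point, small uniformly in [nu n],
    and the integral between the grid point and [r], controlled by the Lipschitz bound. *)
Lemma euler_functional_cvg :
  euler_functional B s t n (nu n) w @[n --> \oo] --> exp_functional B r w.
Proof.
have [C C0 lip] := exp_functional_lipschitz w t.
apply/cvgrPdist_le => e e0.
have e2 : 0 < e / 2 by rewrite divr_gt0.
have eC : 0 < e / 2 / (C + 1) by rewrite divr_gt0// ltr_wpDl.
have := riemann_sum_cvg (extended_exp_mart w) s t (e / 2)
  (continuous_extended_exp_mart w) s0 st e2.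
move/cvgrPdist_le : (xr) => /(_ _ eC) => xr' rs.
apply: filterS2 xr' rs => n xrn /(_ _ (nun n)) rsn.
rewrite (splitr e).
rewrite (le_trans (ler_distD (exp_functional B (grid s t n (nu n)) w) _ _))//.
rewrite lerD//.
  rewrite (le_trans (lip _ _ _ (x0t n)))//; first by case/andP: srt => _ ->; rewrite r0.
  rewrite (le_trans (ler_wpM2l C0 xrn))// mulrCA ler_piMr ?(ltW e2)//.
  by rewrite ler_pdivrMr ?ltr_wpDl// mul1r lerDl.
rewrite distrC /euler_functional !exp_functionalE.
under eq_bigr => j _.
  rewrite -extended_exp_martE; last by rewrite (le_trans s0)// grid_ge.
  over.
by move: rsn; rewrite opprB addrA [X in `|X|]addrAC [in `|_|]addrC addrA.
Qed.

Lemma euler_exponent_cvg c : 0 <= c ->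
  euler_exponent B c s t n (nu n) w @[n --> \oo] --> bond_exponent B c r w.
Proof.
move=> c0; apply: cvgM; first by apply: cvgMr; exact: exp_mart_grid_cvg.
apply: cvgV; first by rewrite gt_eqF// ltr_pwDl// mulr_ge0// exp_functional_ge0.
by apply: cvgD; [exact: cvg_cst|apply: cvgMl; exact: euler_functional_cvg].
Qed.

End grid_limit.

Lemma euler_functional_end_cvg s t w : 0 <= s -> s <= t ->
  euler_functional B s t n n.+1 w @[n --> \oo] --> exp_functional B t w.
Proof.
move=> s0 st; apply: (euler_functional_cvg s t t S w) => //; first by rewrite st lexx.
by move=> n; rewrite grid_end subrr normr0 mesh_ge0.
Qed.

End continuous_paths.

(** * The scheme up to a random time *)

Section stopped_scheme.
Context {Omega : Type} {R : realType}.
Variable B : R -> Omega -> R.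
Hypothesis cB : forall w, {within `[0, +oo[%classic, continuous (fun t => B t w)}.
Variable tau : Omega -> \bar R.
Hypothesis tau0 : forall w, (0 <= tau w)%E.

Definition stopped_time (t : R) (w : Omega) : R := fine (Order.min t%:E (tau w)).

Lemma stopped_timeE t w : (t%:E <= tau w)%E -> stopped_time t w = t.
Proof. by move=> tt; rewrite /stopped_time min_l. Qed.

Lemma EFin_stopped_time t w : (tau w <= t%:E)%E -> (stopped_time t w)%:E = tau w.
Proof.
move=> tt; rewrite /stopped_time min_r// fineK// ge0_fin_numE//.
by rewrite (le_lt_trans tt)// ltry.
Qed.

Lemma stopped_time_le t w : stopped_time t w <= t.
Proof.
have [tt|tt] := leP t%:E (tau w); first by rewrite stopped_timeE.
by rewrite -lee_fin EFin_stopped_time// ltW.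
Qed.

Lemma stopped_time_ge s t w : s <= t -> (s%:E <= tau w)%E -> s <= stopped_time t w.
Proof.
move=> st sw; have [tt|tt] := leP t%:E (tau w); first by rewrite stopped_timeE.
by rewrite -lee_fin EFin_stopped_time// ltW.
Qed.

Lemma stopped_time_ge0 t w : 0 <= t -> 0 <= stopped_time t w.
Proof. by move=> t0; apply: stopped_time_ge. Qed.

(** Whether step [j] counts is decided at its left endpoint. For a stopping time this is an event of
    the filtration at that grid time, hence independent of the increment that follows. *)
Definition stopped_sum (c s t : R) (f : R -> R) (n : nat) (w : Omega) : R :=
  \sum_(j < n.+1) (if ((grid s t n j)%:E < tau w)%E then
    f (euler_exponent B c s t n j.+1 w) - f (euler_exponent B c s t n j w) else 0).

(** The sum ends at the first grid point not before [tau], or at [t], hence at most one mesh after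
    the stopped time. If [tau <= s] nothing is summed, and [s] may be far from the stopped time, so
    that case has its own clause. *)
Lemma stopped_sum_telescope c s t f n w : s <= t ->
  exists nu, [/\ (nu <= n.+1)%N,
    (s%:E < tau w)%E -> `|grid s t n nu - stopped_time t w| <= (t - s) / n.+1%:R,
    (tau w <= s%:E)%E -> nu = 0%N
    & stopped_sum c s t f n w
      = f (euler_exponent B c s t n nu w) - f (euler_exponent B c s t n 0 w)].
Proof.
move=> st.
have [|nu [nun live dead sumE]] := telescope_until R
  (fun j => ((grid s t n j)%:E < tau w)%E)
  (fun j => f (euler_exponent B c s t n j w)) n.+1.
  by move=> j; apply: le_lt_trans; rewrite lee_fin le_grid.
exists nu; split => // [sw|ws]; last first.
  case: nu live {nun dead sumE} => // nu /(_ 0%N isT).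
  by rewrite grid0 ltNge ws.
have nu0 : (0 < nu)%N.
  by case: nu dead {live nun sumE} => // /(_ isT); rewrite grid0 sw.
have lower : grid s t n nu - (t - s) / n.+1%:R <= stopped_time t w.
  case: nu nu0 live nun {dead sumE} => // nu _ live nun.
  rewrite gridS addrK; apply: stopped_time_ge; last exact/ltW/live.
  exact/grid_le/ltnW.
have upper : stopped_time t w <= grid s t n nu.
  have [->|nuN] := eqVneq nu n.+1; first by rewrite grid_end stopped_time_le.
  have /dead : (nu < n.+1)%N by rewrite ltn_neqAle nuN.
  rewrite -leNgt => wg.
  rewrite -lee_fin EFin_stopped_time// (le_trans wg)// lee_fin.
  exact: grid_le.
rewrite ger0_norm ?subr_ge0//.
by rewrite lerBlDr -lerBlDl.
Qed.

Lemma stopped_sum_cvg c s t f w : 0 <= c -> 0 <= s -> s <= t -> continuous f ->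
  stopped_sum c s t f n w @[n --> \oo] -->
  f (bond_exponent B c (stopped_time t w) w)
  - f (bond_exponent B c (stopped_time s w) w).
Proof.
move=> c0 s0 st cf.
have [nu nuP] := choice (fun n => stopped_sum_telescope c s t f n w st).
rewrite (_ : (fun _ => _) = fun n => f (euler_exponent B c s t n (nu n) w)
    - f (bond_exponent B c s w)); last first.
  by apply/funext => n; have [_ _ _ ->] := nuP n; rewrite euler_exponent0.
have [sw|ws] := ltP s%:E (tau w).
  rewrite (stopped_timeE s w (ltW sw)).
  apply: cvgB; last exact: cvg_cst.
  apply: continuous_cvg; first exact: cf.
  apply: (euler_exponent_cvg B cB s t _ nu w) => //.
  - by rewrite stopped_time_le stopped_time_ge// ltW.
  - by move=> n; case: (nuP n).
  - by move=> n; case: (nuP n) => _ /(_ sw).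
rewrite (_ : stopped_time t w = stopped_time s w); last first.
  apply: EFin_inj; rewrite !EFin_stopped_time//.
  by rewrite (le_trans ws)// lee_fin.
rewrite subrr (_ : (fun _ => _) = fun=> 0); first exact: cvg_cst.
apply/funext => n; have [_ _ /(_ ws) -> _] := nuP n.
by rewrite euler_exponent0 subrr.
Qed.

End stopped_scheme.

(** * Martingale property of the stopped process *)

Section stopped_measurability.
Context d (Omega : measurableType d) (R : realType) (P : probability Omega R).
Variables (F : R -> set (set Omega)) (B : R -> Omega -> R).
Hypotheses (filF : is_filtration F) (BM : standard_brownian_motion P F B).

Let cB : forall w, {within `[0, +oo[%classic, continuous (fun t => B t w)}.
Proof. by case: BM. Qed.

Let wrtP t (t0 : 0 <= t) (Y : Omega -> R) : measurable_wrt (F t) Y <->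
  measurable_fun setT (Y : g_sigma_algebraType (F t) -> R).
Proof. exact/measurable_wrtP/(filtration_sigma _ _ _ _ filF). Qed.

Lemma measurable_wrt_mono s t (Y : Omega -> R) : 0 <= s -> s <= t ->
  measurable_wrt (F s) Y -> measurable_wrt (F t) Y.
Proof. by case: filF => _ _ mono s0 st mY D mD; exact/(mono s t)/mY. Qed.

Lemma exp_mart_measurable u t : 0 <= u -> u <= t ->
  measurable_wrt (F t) (exp_mart B u).
Proof.
move=> u0 ut; apply: (measurable_wrt_mono u t) => //; apply/wrtP => //.
apply: measurableT_comp => //; apply: measurable_funB => //.
by apply/wrtP => //; case: BM => + _ _ _ _; exact.
Qed.

Let exp_mart_measurable' u t : 0 <= u -> u <= t ->
  measurable_fun setT (exp_mart B u : g_sigma_algebraType (F t) -> R).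
Proof.
by move=> u0 ut; apply/wrtP; [exact: le_trans ut|exact: exp_mart_measurable].
Qed.

(** A pointwise limit of left Riemann sums over times in [[0, t]], each of them measurable with
    respect to [F t]. *)
Lemma exp_functional_measurable t : 0 <= t -> measurable_wrt (F t) (exp_functional B t).
Proof.
move=> t0; apply/wrtP => //.
apply: (@measurable_fun_cvg _ (g_sigma_algebraType (F t)) R setT (fun n w =>
  euler_functional B 0 t n n.+1 w)); last first.
  by move=> w _; exact: euler_functional_end_cvg.
move=> n; rewrite /euler_functional.
under eq_fun do rewrite exp_functional0 add0r.
apply: measurable_sum => j; apply: measurable_funM => //.
by apply: exp_mart_measurable'; [exact: grid_ge|apply: grid_le => //; exact: ltnW].
Qed.

Lemma euler_exponent_measurable c s t n k : 0 <= c -> 0 <= s -> s <= t ->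
  measurable_wrt (F (grid s t n k)) (euler_exponent B c s t n k).
Proof.
move=> c0 s0 st; have sk := grid_ge s t n st k; have g0 := le_trans s0 sk.
apply/wrtP => //.
apply: measurable_funM.
  by apply: measurable_funM => //; exact: exp_mart_measurable'.
apply: measurable_fun_invr.
  by move=> w; rewrite ltr_pwDl// mulr_ge0// euler_functional_ge0.
apply: measurable_funD => //; apply: measurable_funM => //.
apply: measurable_funD.
  apply/wrtP => //; apply: (measurable_wrt_mono s) => //.
  exact: exp_functional_measurable.
apply: measurable_sum => j; apply: measurable_funM => //.
apply: exp_mart_measurable'; first exact: le_trans (grid_ge s t n st j).
by apply: le_grid => //; exact: ltnW.
Qed.

Variable tau : Omega -> \bar R.
Hypothesis stau : stopping_time F tau.

Lemma before_stopping t : 0 <= t -> F t [set w | (t%:E < tau w)%E].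
Proof.
move=> t0; have [_ FC _] := filtration_sigma _ _ _ _ filF t t0.
rewrite (_ : mkset _ = setT `\` [set w | (tau w <= t%:E)%E]).
  by apply: FC; case: stau => _; exact.
apply/seteqP; split => w /=; first by rewrite ltNge => /negP.
by case=> _ /negP; rewrite -ltNge.
Qed.

Lemma measurable_before u t : 0 <= u -> u <= t ->
  measurable_fun setT ((fun w => (u%:E < tau w)%E) : g_sigma_algebraType (F t) -> bool).
Proof.
move=> u0 ut; have t0 := le_trans u0 ut.
apply: (measurable_fun_bool true); rewrite setTI.
rewrite measurable_g_measurableTypeE; last exact: filtration_sigma _ _ _ _ filF t t0.
by case: filF => _ _ mono; apply: (mono u t) => //; exact: before_stopping.
Qed.

Lemma stopped_sum_measurable c s t (f : R -> R) n : 0 <= c -> 0 <= s -> s <= t ->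
  measurable_fun setT f -> measurable_wrt (F t) (stopped_sum B tau c s t f n).
Proof.
move=> c0 s0 st mf; apply/wrtP; first exact: le_trans st.
apply: measurable_sum => j.
have g0 : 0 <= grid s t n j.+1 by rewrite (le_trans s0)// grid_ge.
have gt : grid s t n j.+1 <= t by exact: grid_le.
apply/wrtP; first exact: le_trans st.
apply: (measurable_wrt_mono _ _ _ g0 gt); apply/wrtP => //.
have gj0 : 0 <= grid s t n j by rewrite (le_trans s0)// grid_ge.
have gjS : grid s t n j <= grid s t n j.+1 by exact: le_grid.
apply: measurable_fun_ifT => //.
- exact: measurable_before.
- apply: measurable_funB; apply: (measurableT_comp mf); apply/wrtP => //.
    exact: euler_exponent_measurable.
  apply: (measurable_wrt_mono _ _ _ gj0 gjS).
  exact: euler_exponent_measurable.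
Qed.

(** The scheme itself supplies the approximation: with [f = id] and [s = 0], [stopped_sum] plus the
    initial value converges to the stopped exponent, and every term is measurable with respect to
    [F t]. *)
Lemma bond_exponent_stopped_measurable c t : 0 <= c -> 0 <= t ->
  measurable_wrt (F t) (fun w => bond_exponent B c (stopped_time tau t w) w).
Proof.
move=> c0 t0; have tau0 : forall w, (0 <= tau w)%E by case: stau.
have eu0 w : bond_exponent B c 0 w = euler_exponent B c 0 t 0 0 w.
  by rewrite euler_exponent0.
apply/wrtP => //.
apply: (@measurable_fun_cvg _ (g_sigma_algebraType (F t)) R setT (fun n w =>
  stopped_sum B tau c 0 t id n w + bond_exponent B c 0 w)).
  move=> n; apply: measurable_funD.
    by apply/wrtP => //; exact: stopped_sum_measurable.
  apply/wrtP => //; apply: (measurable_wrt_mono 0) => //.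
  rewrite (_ : bond_exponent B c 0 = euler_exponent B c 0 t 0 0).
    by have := euler_exponent_measurable c 0 t 0 0 c0 (lexx 0) t0; rewrite grid0.
  exact/funext.
move=> w _.
have := stopped_sum_cvg B cB tau tau0 c 0 t id w c0 (lexx 0) t0 (fun _ => cvg_id).
rewrite (stopped_timeE tau 0 w (tau0 w)) => sc.
rewrite -[X in _ --> X](subrK (bond_exponent B c 0 w)).
by apply: cvgD; [exact: sc|exact: cvg_cst].
Qed.

Section optional_stopping.
Variables (c L : R).
Hypotheses (c0 : 0 <= c)
  (tauL : forall u w, 0 <= u -> (u%:E < tau w)%E -> B u w <= L).
Let K := expR L.
Let phi := truncexp c K.

Lemma euler_exponent_before s t n j w : 0 <= s -> s <= t ->
  ((grid s t n j)%:E < tau w)%E -> 0 <= euler_exponent B c s t n j w <= K.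
Proof.
move=> s0 st alive; have g0 : 0 <= grid s t n j by rewrite (le_trans s0)// grid_ge.
rewrite euler_exponent_ge0//= (le_trans (euler_exponent_le _ _ _ _ _ _ _ _ _))//.
by rewrite ler_expR lerBlDr ler_wpDr ?divr_ge0// tauL.
Qed.

Let summand s t n j w := if ((grid s t n j)%:E < tau w)%E then
  phi (euler_exponent B c s t n j.+1 w) - phi (euler_exponent B c s t n j w) else 0.

Lemma stopped_increment_bound : exists2 C, 0 <= C & forall E s t n j,
  0 <= s -> s < t -> (t - s) / n.+1%:R <= 1 / 12 -> F s E ->
  `|\int[P]_(w in E) summand s t n j w|
    <= C * ((t - s) / n.+1%:R * Num.sqrt ((t - s) / n.+1%:R)).
Proof.
have [C C0 step] := brownian_step _ _ _ _ _ _ filF BM c K c0 (expR_ge0 L).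
exists C => // E s t n j s0 slt hS FE; have st := ltW slt.
set gj := grid s t n j; set gj1 := grid s t n j.+1.
have gj0 : 0 <= gj by rewrite (le_trans s0)// grid_ge.
have hE : gj1 - gj = (t - s) / n.+1%:R by rewrite /gj1 gridS addrC addKr.
have sgj : s <= gj by exact: grid_ge.
(* Since 0 is a fixed point of [euler_step], setting [Z] to 0 off the event
   makes the increment of [phi] vanish there. *)
pose Z w := if w \in E then
  if (gj%:E < tau w)%E then euler_exponent B c s t n j w else 0 else 0.
have mZ : measurable_wrt (F gj) Z.
  apply/wrtP => //; apply: measurable_fun_ifT => //.
    apply: (measurable_fun_bool true); rewrite setTI.
    rewrite measurable_g_measurableTypeE;
      last exact: filtration_sigma _ _ _ _ filF gj gj0.
    rewrite (_ : _ @^-1` _ = E).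
      by case: filF => _ _ mono; exact: (mono s gj).
    by apply/seteqP; split => w /=; [move/set_mem|move/mem_set].
  apply: measurable_fun_ifT => //; first exact: measurable_before.
  by apply/wrtP => //; exact: euler_exponent_measurable.
have ZK w : 0 <= Z w <= K.
  rewrite /Z; case: ifPn => _; last by rewrite lexx expR_ge0.
  case: ifPn => alive; last by rewrite lexx expR_ge0.
  exact: euler_exponent_before.
have := step Z gj gj1 gj0; rewrite -subr_gt0 hE.
move=> /(_ _ hS mZ ZK); rewrite divr_gt0 ?subr_gt0// => /(_ isT).
congr (`|_| <= _); rewrite [RHS]Rintegral_mkcond; apply: eq_Rintegral => w _.
rewrite patchE /Z; case: ifPn => wE; last first.
  by rewrite /euler_step !mul0r subrr.
rewrite /summand -/gj; case: ifPn => alive; last by rewrite /euler_step !mul0r subrr.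
by rewrite euler_exponentS.
Qed.

Let tau0 : forall w, (0 <= tau w)%E. Proof. by case: stau. Qed.

Let M := expR (c * (K + 1)).

Let phi_bound x y : `|phi x - phi y| <= M.
Proof.
have [x0 y0] := (truncexp_gt0 R c K x, truncexp_gt0 R c K y).
have [xM yM] := (truncexp_le R c K x c0, truncexp_le R c K y c0).
by rewrite ler_distl; apply/andP; split; rewrite -/phi -/M in x0 y0 xM yM *; lra.
Qed.

Let mphi : measurable_fun setT phi. Proof. exact: measurable_truncexp. Qed.

Let measurable_ambient t (Y : Omega -> R) : 0 <= t ->
  measurable_wrt (F t) Y -> measurable_fun setT Y.
Proof. by move=> t0; exact/measurable_wrt_fun/(filtration_sub _ _ _ _ filF). Qed.

Let measurable_event s E : 0 <= s -> F s E -> measurable E.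
Proof. by move=> s0; exact: (filtration_sub _ _ _ _ filF). Qed.

Let summand_integrable E s t n j : 0 <= s -> s <= t -> (j < n.+1)%N -> measurable E ->
  P.-integrable E (EFin \o summand s t n j).
Proof.
move=> s0 st jn mE.
apply: (@integrableS _ _ _ _ setT) => //.
apply: (integrable_of_bounded _ _ _ _ _ M) => [|w]; last first.
  by rewrite /summand; case: ifP => _; [exact: phi_bound|rewrite normr0 expR_ge0].
have g0 k : 0 <= grid s t n k by rewrite (le_trans s0)// grid_ge.
have me k : measurable_fun setT (euler_exponent B c s t n k).
  by apply: (measurable_ambient _ _ (g0 k)); exact: euler_exponent_measurable.
rewrite (_ : summand s t n j = fun w =>
    if (w \in [set w | ((grid s t n j)%:E < tau w)%E])
    then phi (euler_exponent B c s t n j.+1 w)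
      - phi (euler_exponent B c s t n j w) else 0).
  apply: measurable_fun_ifT => //; last first.
    by apply: measurable_funB; exact: (measurableT_comp mphi).
  apply: (measurable_fun_bool true); rewrite setTI.
  rewrite (_ : _ @^-1` _ = [set w | ((grid s t n j)%:E < tau w)%E]).
    by apply: (measurable_event _ _ (g0 j)); exact: before_stopping.
  by apply/seteqP; split => w /=; [move/set_mem|move/mem_set].
apply/funext => w; rewrite /summand.
by case: ifPn => h; [rewrite mem_set|rewrite memNset//; exact/negP].
Qed.

Let sum_bound E s t n e k : 0 <= s -> s <= t -> (k <= n.+1)%N -> measurable E ->
  (forall j, `|\int[P]_(w in E) summand s t n j w| <= e) ->
  P.-integrable E (EFin \o (fun w => \sum_(j < k) summand s t n j w)) /\
  `|\int[P]_(w in E) (\sum_(j < k) summand s t n j w)| <= k%:R * e.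
Proof.
move=> s0 st kn mE be; elim: k kn => [|k IH] kn.
  under [X in P.-integrable _ (EFin \o X)]eq_fun do rewrite big_ord0.
  under [X in `|X|]eq_Rintegral do rewrite big_ord0.
  rewrite Rintegral_cst// mul0r normr0 mul0r; split => //.
  exact: integrable0.
have [I1 I2] := IH (ltnW kn).
have I3 := summand_integrable E s t n k s0 st kn mE.
under [X in P.-integrable _ (EFin \o X)]eq_fun do rewrite big_ord_recr/=.
under [X in `|X|]eq_Rintegral do rewrite big_ord_recr/=.
split; first by have := integrableD mE I1 I3.
rewrite RintegralD// -natr1 mulrDl mul1r (le_trans (ler_normD _ _))//.
by rewrite lerD.
Qed.

Lemma optional_stopping E s t : 0 <= s -> s <= t -> F s E ->
  \int[P]_(w in E) phi (bond_exponent B c (stopped_time tau t w) w)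
  = \int[P]_(w in E) phi (bond_exponent B c (stopped_time tau s w) w).
Proof.
move=> s0 st FE; have mE := measurable_event s E s0 FE; have t0 := le_trans s0 st.
have [->//|sNt] := eqVneq s t; have slt : s < t by rewrite lt_neqAle sNt.
pose Yt w := phi (bond_exponent B c (stopped_time tau t w) w).
pose Ys w := phi (bond_exponent B c (stopped_time tau s w) w).
have mY u : 0 <= u -> measurable_fun setT
    (fun w => phi (bond_exponent B c (stopped_time tau u w) w)).
  move=> u0; apply: (measurableT_comp mphi); apply: (measurable_ambient _ _ u0).
  exact: bond_exponent_stopped_measurable.
have iY u : 0 <= u -> P.-integrable E
    (EFin \o (fun w => phi (bond_exponent B c (stopped_time tau u w) w))).
  move=> u0; apply: (@integrableS _ _ _ _ setT) => //.
  apply: (integrable_of_bounded _ _ _ _ _ M); first exact: mY.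
  by move=> w; rewrite ger0_norm ?expR_ge0// truncexp_le.
apply/eqP; rewrite -subr_eq0 -RintegralB//; [|exact: iY|exact: iY].
pose S n w := stopped_sum B tau c s t phi n w.
have SE n w : S n w = \sum_(j < n.+1) summand s t n j w by [].
have Scvg w : S n w @[n --> \oo] --> Yt w - Ys w.
  by apply: stopped_sum_cvg => //; exact: continuous_truncexp.
(* Telescoping leaves a difference of two values of [phi], which gives a bound uniform in [n] for
   dominated convergence. *)
have SM n w : `|S n w| <= M.
  have [nu [_ _ _]] := stopped_sum_telescope B tau tau0 c s t phi n w st.
  by rewrite /S => ->; exact: phi_bound.
have mS n : measurable_fun setT (S n).
  by apply: (measurable_ambient _ _ t0); exact: stopped_sum_measurable.
have mD : measurable_fun setT (fun w => Yt w - Ys w).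
  by apply: measurable_funB; exact: mY.
have [C C0 bound] := stopped_increment_bound.
have lim0 : \int[P]_(w in E) S n w @[n --> \oo] --> (0 : R).
  pose h n := (t - s) / n.+1%:R.
  (* The [n.+1] errors [C h sqrt h] add up to [C (t - s) sqrt h]. *)
  have hc : C * (t - s) * Num.sqrt (h n) @[n --> \oo] --> (0 : R).
    rewrite -[X in _ --> X](mulr0 (C * (t - s))); apply: cvgMr.
    rewrite -[X in _ --> X]sqrtr0; apply: continuous_cvg; first exact: sqrt_continuous.
    exact: mesh_cvg0.
  apply/cvgrPdist_le => e e0.
  have /cvgrPdist_le/(_ _ e0) := hc.
  have /cvgrPdist_le/(_ (1 / 12)) := mesh_cvg0 R s t.
  rewrite divr_gt0// => /(_ isT); apply: filterS2 => n.
  rewrite !sub0r !normrN ger0_norm ?mesh_ge0// => hS he.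
  have [_] := sum_bound E s t n _ n.+1 s0 st (leqnn _) mE
    (fun j => bound E s t n j s0 slt hS FE).
  rewrite -/(h n) => /le_trans; apply; apply: le_trans he.
  rewrite (le_trans _ (ler_norm _))// /h le_eqVlt; apply/orP; left; apply/eqP.
  by set q := Num.sqrt _; field.
have limI : \int[P]_(w in E) S n w @[n --> \oo] --> \int[P]_(w in E) (Yt w - Ys w).
  have [] := @dominated_convergence _ _ _ P E mE (fun n => EFin \o S n)
    (EFin \o (fun w => Yt w - Ys w)) (EFin \o cst M).
  - by move=> n; apply/measurable_EFinP; apply: measurable_funTS.
  - by apply/measurable_EFinP; apply: measurable_funTS.
  - by apply: aeW => w _; apply: cvg_EFin; [exact: nearW|exact: Scvg].
  - exact: finite_measure_integrable_cst.
  - by apply: aeW => w n _ /=; rewrite lee_fin.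
  move=> iD _ dc; apply: fine_cvg; rewrite fineK//.
  exact: integrable_fin_num iD.
apply/eqP; transitivity (limn (fun n => \int[P]_(w in E) S n w)).
  by symmetry; apply: cvg_lim; [exact: norm_hausdorff|exact: limI].
by apply: cvg_lim; [exact: norm_hausdorff|exact: lim0].
Qed.

End optional_stopping.
End stopped_measurability.

(** * Hitting times *)

Section hitting_time.
Context {Omega : Type} {R : realType}.
Variable B : R -> Omega -> R.
Hypothesis cB : forall w, {within `[0, +oo[%classic, continuous (fun t => B t w)}.

(** The infimum is taken in the extended reals, so it is [+oo] on paths that never reach [L]. *)
Definition hitting_time (L : R) (w : Omega) : \bar R :=
  ereal_inf [set t%:E | t in [set t | 0 <= t /\ L <= B t w]].

Lemma hitting_time_ge0 L w : (0 <= hitting_time L w)%E.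
Proof. by apply/ereal_infP => _ [t [t0 _] <-]; rewrite lee_fin. Qed.

Lemma hitting_time_le L u w : 0 <= u -> L <= B u w -> (hitting_time L w <= u%:E)%E.
Proof. by move=> u0 Lu; apply: ge_ereal_inf; exists u%:E => //; exists u. Qed.

Lemma before_hitting_time L u w : 0 <= u -> (u%:E < hitting_time L w)%E -> B u w < L.
Proof.
move=> u0; apply: contraTT; rewrite -!leNgt => Lu.
exact: hitting_time_le.
Qed.

Lemma le_hitting_time L L' w : L <= L' -> (hitting_time L w <= hitting_time L' w)%E.
Proof.
move=> LL'; apply: ereal_inf_le_tmp => _ [t [t0 Lt] <-]; exists t => //.
by split=> //; exact: le_trans Lt.
Qed.

(** The infimum is attained: a path below [L] on all of [[0, t]] stays below it a little longer by
    continuity, so its hitting time exceeds [t]. *)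
Lemma hitting_time_leP L t w : 0 <= t ->
  (hitting_time L w <= t%:E)%E <-> exists2 u, 0 <= u <= t & L <= B u w.
Proof.
move=> t0; split=> [|[u /andP[u0 ut] Lu]]; last first.
  apply: (@le_trans _ _ u%:E); last by rewrite lee_fin.
  exact: hitting_time_le.
move=> ht; apply: contrapT => none.
have low u : 0 <= u <= t -> B u w < L.
  by move=> ut; rewrite ltNge; apply/negP => Lu; apply: none; exists u.
have tt : B (Num.max 0 t) w < L by rewrite max_r// low// t0 lexx.
have /cvgr_lt/(_ _ tt)/nbhs_normP[r /= r0 br] := continuous_extended_path B cB w t.
have : ((t + r)%:E <= hitting_time L w)%E.
  apply/ereal_infP => _ [u [u0 Lu] <-]; rewrite lee_fin leNgt; apply/negP => utr.
  have [ut|tu] := leP u t; first by have := low u; rewrite u0 ut ltNge Lu => /(_ isT).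
  have : B (Num.max 0 u) w < L.
    by apply: br => /=; rewrite distrC gtr0_norm ?subr_gt0// ltrBlDl.
  by rewrite max_r// ltNge Lu.
by move=> /le_trans/(_ ht); rewrite lee_fin gerDl leNgt r0.
Qed.

Lemma hitting_time_cvgy w : hitting_time n%:R w @[n --> \oo] --> +oo%E.
Proof.
apply/cvgeyPge => A.
pose A' := Num.max 0 A.
have A'0 : 0 <= A' by rewrite le_max lexx.
have [x _ xmax] := EVT_max A'0 (continuous_subspaceT (continuous_extended_path B cB w)).
near=> n; rewrite (@le_trans _ _ A'%:E)//; first by rewrite lee_fin le_max lexx orbT.
rewrite leNgt; apply/negP => /ltW /(hitting_time_leP _ _ _ A'0)[u uA].
have := xmax u; rewrite in_itv/= uA => /(_ isT); rewrite max_r; last by case/andP: uA.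
move=> h1 h2; have := le_trans h2 h1; rewrite leNgt => /negP; apply.
near: n; exact: nbhs_infty_gtr.
Unshelve. all: by end_near.
Qed.

(** A stopped value above [L] would, by continuity, be preceded by an earlier time above [L],
    against the definition of the infimum; [B 0 w <= L] ensures that there is an earlier time. *)
Lemma stopped_path_le L t w : 0 <= t -> B 0 w <= L ->
  B (stopped_time (hitting_time L) t w) w <= L.
Proof.
move=> t0 B0; set r := stopped_time _ _ _.
have r0 : 0 <= r by exact: stopped_time_ge0 (hitting_time_ge0 L) _ _ t0.
have rh : (r%:E <= hitting_time L w)%E.
  have [th|ht] := leP t%:E (hitting_time L w).
    by rewrite /r (stopped_timeE _ _ _ th).
  by rewrite /r (EFin_stopped_time _ (hitting_time_ge0 L))// ltW.
rewrite leNgt; apply/negP => LB.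
have rgt : 0 < r.
  by rewrite lt_neqAle r0 andbT; apply: contraTneq LB => <-; rewrite -leNgt.
have LB' : L < B (Num.max 0 r) w by rewrite max_r.
have /cvgr_gt/(_ _ LB')/nbhs_normP[e /= e0 be] := continuous_extended_path B cB w r.
pose u := Num.max 0 (r - e / 2).
have e2 : 0 < e / 2 by rewrite divr_gt0.
have ur : u < r by rewrite /u gt_max rgt/= ltrBlDr ltrDl.
have u0 : 0 <= u by rewrite le_max lexx.
have : L < B (Num.max 0 u) w.
  apply: be => /=; rewrite gtr0_norm ?subr_gt0// (@le_lt_trans _ _ (e / 2))//.
    by rewrite lerBlDl -lerBlDr le_max lexx orbT.
  by rewrite ltr_pdivrMr// ltr_pMr// ltr1n.
rewrite max_r// => /ltW Lu.
have : (hitting_time L w <= u%:E)%E by exact: hitting_time_le.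
by move=> /(le_trans rh); rewrite lee_fin leNgt ur.
Qed.

(* By continuity the supremum over [[0, t]] is a countable one; [max 0] and
   [min t] bring the rationals into [[0, t]]. *)
Lemma hitting_time_le_rat L t w : 0 <= t ->
  (hitting_time L w <= t%:E)%E <->
  forall k : nat, exists q : rat,
    L - k.+1%:R^-1 < B (Num.max 0 (Num.min (ratr q) t)) w.
Proof.
move=> t0; split.
  move=> /(hitting_time_leP _ _ _ t0)[u /andP[u0 ut] Lu] k.
  have : L - k.+1%:R^-1 < B (Num.max 0 u) w.
    by rewrite max_r// (lt_le_trans _ Lu)// ltrBlDr ltrDl invr_gt0.
  have /cvgr_gt := continuous_extended_path B cB w u.
  move=> /[apply] /nbhs_normP[r /= r0 br].
  have [q] := @rat_in_itvoo R (u - r) (u + r) ltac:(lra).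
  rewrite in_itv/= => /andP[q1 q2]; exists q.
  have -> : Num.max 0 (Num.min (ratr q) t) = Num.max 0 (Num.max 0 (Num.min (ratr q) t)).
    by rewrite [RHS]max_r// le_max lexx.
  apply: br => /=; rewrite ltr_distlC; apply/andP; split.
    by rewrite !(lt_max, lt_min) q1 (lt_le_trans _ ut) ?ltrBlDr ?ltrDl ?orbT.
  by rewrite gt_max gt_min q2/= ltr_wpDl.
move=> H; apply/(hitting_time_leP _ _ _ t0); apply: contrapT => none.
have [x xt xmax] := EVT_max t0 (continuous_subspaceT (continuous_extended_path B cB w)).
have xL : B x w < L.
  by rewrite ltNge; apply/negP => Lx; apply: none; exists x.
have d0 : 0 < L - B x w by rewrite subr_gt0.
have [k] := ltr_add_invr d0; rewrite add0r => kd.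
have [q] := H k; rewrite ltNge => /negP; apply.
have x0 : 0 <= x by move: xt; rewrite in_itv/= => /andP[].
set y := Num.max 0 _.
have yt : y \in `[0, t].
  by rewrite in_itv/= le_max lexx/= ge_max t0 ge_min lexx orbT.
have := xmax y yt; rewrite (max_r x0) max_r ?le_max ?lexx// => h.
by rewrite (le_trans h)// lerBrDr -lerBrDl ltW.
Qed.

End hitting_time.

Lemma hitting_time_stopping d (Omega : measurableType d) (R : realType)
    (P : probability Omega R) (F : R -> set (set Omega)) (B : R -> Omega -> R) (L : R) :
  is_filtration F -> standard_brownian_motion P F B ->
  stopping_time F (hitting_time B L).
Proof.
move=> filF BM.
have cB w : {within `[0, +oo[%classic, continuous (fun t => B t w)}.
  by case: BM.
split=> [w|t t0]; first exact: hitting_time_ge0.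
have sF := filtration_sigma _ _ _ _ filF t t0.
rewrite (_ : mkset _ = \bigcap_(k : nat) \bigcup_(q : rat)
    [set w | L - k.+1%:R^-1 < B (Num.max 0 (Num.min (ratr q) t)) w]).
  rewrite -(measurable_g_measurableTypeE sF).
  apply: bigcapT_measurable => k; apply: bigcupT_measurable_rat => q.
  set u := Num.max _ _.
  have [u0 ut] : 0 <= u /\ u <= t.
    by rewrite le_max lexx/= ge_max t0 ge_min lexx orbT.
  rewrite measurable_g_measurableTypeE// -preimage_itvoy.
  apply: (measurable_wrt_mono _ _ _ _ filF u t (B u) u0 ut) => //.
  by case: BM => + _ _ _ _; exact.
apply/seteqP; split => w /=.
  by move=> /(hitting_time_le_rat B cB L t w t0) H k _; have [q] := H k; exists q.
move=> H; apply/(hitting_time_le_rat B cB L t w t0) => k.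
by have [q _] := H k I; exists q.
Qed.

(** * Nonnegative rate *)

Lemma integrable_ae_eq d (T : measurableType d) (R : realType)
    (mu : {measure set T -> \bar R}) (f g : T -> R) :
  measurable_fun setT f -> mu.-integrable setT (EFin \o g) ->
  {ae mu, forall x, f x = g x} -> mu.-integrable setT (EFin \o f).
Proof.
move=> /measurable_EFinP mf /integrableP[mg intg] fg; apply/integrableP; split => //.
rewrite (ge0_ae_eq_integral _ _ _ _ _ (g := fun x => `|(EFin \o g) x|%E))//.
- exact: measurableT_comp.
- exact: measurableT_comp.
- by apply: filterS fg => x /= -> _.
Qed.

Section continuous_bond.
Context {Omega : Type} {R : realType}.
Variable B : R -> Omega -> R.
Hypothesis cB : forall w, {within `[0, +oo[%classic, continuous (fun t => B t w)}.

Lemma continuous_extended_functional w :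
  continuous (fun u : R => exp_functional B (Num.max 0 u) w).
Proof.
move=> x; have [C C0 lip] := exp_functional_lipschitz B cB w (Num.max 0 (x + 1)).
have max0 (u : R) : 0 <= Num.max 0 u by rewrite le_max lexx.
have cmax : Num.max 0 u @[u --> x] --> Num.max 0 x.
  by apply: (@continuous_max R R (cst 0) id) => //; exact: cvg_cst.
have maxle v : v <= x + 1 -> 0 <= Num.max 0 v <= Num.max 0 (x + 1).
  by move=> vx; rewrite max0/= ge_max max0/= le_max vx orbT.
apply/cvgrPdist_le => e e0.
have eC : 0 < e / (C + 1) by rewrite divr_gt0// ltr_wpDl.
have /cvgrPdist_le/(_ _ eC) := cmax.
have xlt : x < x + 1 by rewrite ltrDl.
have : \forall u \near x, u <= x + 1 by near do apply: ltW; exact: lt_nbhsl.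
apply: filterS2 => u ux ue.
rewrite (le_trans (lip _ _ (maxle _ (ltW xlt)) (maxle _ ux)))//.
rewrite (le_trans (ler_wpM2l C0 ue))// mulrCA ler_piMr ?(ltW e0)//.
by rewrite ler_pdivrMr ?ltr_wpDl// mul1r lerDl.
Unshelve. all: by end_near.
Qed.

Lemma continuous_extended_exponent c w : 0 <= c ->
  continuous (fun u : R => bond_exponent B c (Num.max 0 u) w).
Proof.
move=> c0 x; apply: cvgM.
  by apply: cvgMr; exact: continuous_extended_exp_mart.
apply: cvgV.
  by rewrite gt_eqF// ltr_pwDl// mulr_ge0// exp_functional_ge0.
apply: cvgD; first exact: cvg_cst.
by apply: cvgMl; exact: continuous_extended_functional.
Qed.

Lemma cadlag_of_extension (T : R) (x : R -> R) :
  continuous (fun u : R => x (Num.max 0 u)) -> cadlag T x.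
Proof.
move=> cx; split=> t /andP[t0 _].
  have := cvg_at_right_filter (cx t); rewrite max_r//; apply: cvg_trans.
  apply: near_eq_cvg; near=> u; rewrite max_r//.
  by rewrite (le_trans t0)//; near: u; apply: nbhs_right_ge.
apply/cvg_ex; exists (x t).
have := cvg_at_left_filter (cx t); rewrite max_r ?(ltW t0)//; apply: cvg_trans.
apply: near_eq_cvg; near=> u; rewrite max_r//.
by near: u; apply: nbhs_left_ge.
Unshelve. all: by end_near.
Qed.

End continuous_bond.

Section nonnegative_rate.
Context d (Omega : measurableType d) (R : realType) (P : probability Omega R).
Variables (F : R -> set (set Omega)) (B : R -> Omega -> R).
Hypotheses (filF : is_filtration F) (BM : standard_brownian_motion P F B).
Variable c : R.
Hypothesis c0 : 0 <= c.

Let X t w := expR (c * bond_exponent B c t w).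

Let cB : forall w, {within `[0, +oo[%classic, continuous (fun t => B t w)}.
Proof. by case: BM. Qed.

Let X_measurable tau t : stopping_time F tau -> 0 <= t ->
  measurable_wrt (F t) (stopped X tau t).
Proof.
move=> stau t0; apply/(measurable_wrtP _ _ _ _ (filtration_sigma _ _ _ _ filF t t0)).
apply: measurableT_comp => //; apply: measurable_funM => //.
apply/(measurable_wrtP _ _ _ _ (filtration_sigma _ _ _ _ filF t t0)).
exact: bond_exponent_stopped_measurable filF BM _ stau _ _ c0 t0.
Qed.

Lemma bond_adapted T : adapted F T X.
Proof.
move=> t /andP[t0 _].
(* Stopping at [+oo] changes nothing, so adaptedness is an instance of the stopped statement. *)
have -> : X t = stopped X (fun=> +oo%E) t.
  by apply/funext => w; rewrite /stopped min_l// leey.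
apply: X_measurable => //; split=> [w|u u0]; first exact: leey.
rewrite (_ : mkset _ = set0); first by case: (filtration_sigma _ _ _ _ filF u u0).
by apply/seteqP; split => w /=; rewrite ?leye_eq.
Qed.

(** Up to the hitting time [2 M / (2 + c A) <= M <= e^n], so the truncation is inactive. Since
    [B 0 = 0] holds only almost surely, the martingale property passes from the truncated process to
    the stopped one by almost sure equality. *)
Let stopped_bounded n t w : 0 <= t -> B 0 w = 0 ->
  stopped X (hitting_time B n%:R) t w = truncexp c (expR n%:R)
    (bond_exponent B c (stopped_time (hitting_time B n%:R) t w) w).
Proof.
move=> t0 B0; rewrite truncexpE// (@le_trans _ _ (expR n%:R))//; last by rewrite lerDl.
set r := stopped_time _ _ _.
have r0 : 0 <= r by exact: stopped_time_ge0 (hitting_time_ge0 B n%:R) _ _ t0.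
have rn : B r w <= n%:R by apply: stopped_path_le => //; rewrite B0.
have A0 : 0 <= exp_functional B r w * c by rewrite mulr_ge0// exp_functional_ge0.
rewrite ler_pdivrMr ?ltr_pwDl// mulrC ler_pM ?expR_ge0//; last by rewrite lerDl.
by rewrite ler_expR lerBlDr (le_trans rn)// lerDl divr_ge0.
Qed.

Lemma bond_local_martingale T : local_martingale P F T X.
Proof.
have ae0 : {ae P, forall w, B 0 w = 0} by case: BM.
split; first exact: bond_adapted.
  apply: aeW => w; apply: cadlag_of_extension => x.
  apply: continuous_comp; last exact: continuous_expR.
  by apply: cvgMr; exact: continuous_extended_exponent.
exists (fun n => hitting_time B n%:R); split.
- by move=> n; exact: hitting_time_stopping filF BM.
- by apply: aeW => w n; apply: le_hitting_time; rewrite ler_nat.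
- by apply: aeW => w; exact: hitting_time_cvgy.
move=> n; have stau : stopping_time F (hitting_time B n%:R).
  exact: hitting_time_stopping filF BM.
set tau := hitting_time B n%:R in stau *.
pose phi := truncexp c (expR n%:R).
pose Y t w := phi (bond_exponent B c (stopped_time tau t w) w).
have mX t : 0 <= t -> measurable_fun setT (stopped X tau t).
  move=> t0; apply: (measurable_wrt_fun _ _ _ _ _ (filtration_sub _ _ _ _ filF t t0)).
  exact: X_measurable.
have mY t : 0 <= t -> measurable_fun setT (Y t).
  move=> t0; apply: (measurableT_comp (measurable_truncexp R _ _)).
  apply: (measurable_wrt_fun _ _ _ _ _ (filtration_sub _ _ _ _ filF t t0)).
  exact: bond_exponent_stopped_measurable filF BM _ stau _ _ c0 t0.
have XY t : 0 <= t -> {ae P, forall w, stopped X tau t w = Y t w}.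
  by move=> t0; apply: filterS ae0 => w; exact: stopped_bounded.
have iX t : 0 <= t -> P.-integrable setT (EFin \o stopped X tau t).
  move=> t0; apply: integrable_ae_eq (mX t t0) _ (XY t t0).
  apply: (integrable_of_bounded _ _ _ _ _ (expR (c * (expR n%:R + 1)))).
    exact: mY.
  by move=> w; rewrite ger0_norm ?expR_ge0// truncexp_le.
have intXY t E : 0 <= t -> measurable E ->
    \int[P]_(w in E) stopped X tau t w = \int[P]_(w in E) Y t w.
  move=> t0 mE; congr fine; apply: ae_eq_integral => //.
  - by apply/measurable_EFinP; apply: measurable_funTS; exact: mX.
  - by apply/measurable_EFinP; apply: measurable_funTS; exact: mY.
  - by apply: filterS (XY t t0) => w /= -> _.
split.
- by move=> t /andP[t0 _]; exact: X_measurable.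
- by move=> t /andP[t0 _]; exact: iX.
move=> s t s0 st tT; have t0 := le_trans s0 st; split.
- exact: iX.
- exact: iX.
- exact: X_measurable.
move=> E FE; have mE := filtration_sub _ _ _ _ filF s s0 E FE.
have tauL u w : 0 <= u -> (u%:E < tau w)%E -> B u w <= n%:R.
  by move=> u0 /(before_hitting_time _ _ _ _ u0)/ltW.
have Eo : \int[P]_(w in E) Y t w = \int[P]_(w in E) Y s w.
  exact: (optional_stopping _ _ _ _ _ _ filF BM tau stau c n%:R c0 tauL _ _ _ s0 st FE).
apply: (etrans (intXY s E s0 mE)); apply: (etrans (esym Eo)).
exact: esym (intXY t E t0 mE).
Qed.

End nonnegative_rate.

(** * Negative rate *)

Section explosion.
Context {Omega : Type} {R : realType}.
Variable B : R -> Omega -> R.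
Hypothesis cB : forall w, {within `[0, +oo[%classic, continuous (fun t => B t w)}.

(* Where the denominator of the exponent vanishes the process takes the junk
   value 1, but its right limit there is infinite. *)
Lemma explosion_not_cadlag c T w : c < 0 -> 0 < T ->
  2 + exp_functional B T w * c < 0 ->
  ~ cadlag T (fun t => expR (c * bond_exponent B c t w)).
Proof.
move=> c0 T0 den.
pose A u := exp_functional B (Num.max 0 u) w.
have cA : continuous A by exact: continuous_extended_functional.
(* The level of [A] at which the denominator [2 + c A] vanishes; [A] crosses it at some [z] strictly
   before [T]. *)
pose K := 2 / - c.
have Kc : K * c = - 2 by rewrite /K -mulrA invrN mulNr mulVf ?lt_eqF// mulrN1.
have K0 : 0 < K by rewrite divr_gt0// oppr_gt0.
have [z zT Az] : exists2 z, z \in `[0, T] & A z = K.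
  apply: (IVT (ltW T0) (continuous_subspaceT cA)).
  rewrite /A max_l// max_r ?(ltW T0)// exp_functional0//.
  rewrite min_l ?max_r ?exp_functional_ge0// (ltW K0)/=.
  by move: den Kc; nra.
move: zT; rewrite in_itv/= => /andP[z0 zleT].
have {}Az : exp_functional B z w = K by rewrite -Az /A max_r.
have zT : z < T.
  rewrite lt_neqAle zleT andbT; apply/eqP => zE.
  by move: den; rewrite -zE Az Kc subrr ltxx.
move=> [/(_ z) + _]; rewrite z0 zT => /(_ isT).
have -> : expR (c * bond_exponent B c z w) = 1.
  by rewrite /bond_exponent Az Kc subrr invr0 !mulr0 expR0.
pose m := exp_mart B z w; have m0 : 0 < m by exact: expR_gt0.
have e1 : 1 < expR 1 :> R by rewrite expR_gt1.
move=> /cvgr_lt/(_ _ e1) Xlt.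
have cm := continuous_extended_exp_mart B cB w z.
rewrite /continuous_at extended_exp_martE// -/m in cm.
have m2 : m / 2 < m by rewrite ltr_pdivrMr// ltr_pMr// ltr1n.
have /nbhs_normP[r /= r0 br] : \forall u \near z, m / 2 < extended_exp_mart B w u.
  exact: (cvgr_gt _ cm _ m2).
have AzK : A z < K + m by rewrite /A max_r// Az ltrDl.
have Alt : \forall u \near z^'+, A u < K + m.
  exact: (cvgr_lt _ (cvg_at_right_filter (cA z)) _ AzK).
(* Just after [z] the exponent [c Y] is [2 M / (A - K)] with [M >= m / 2] and [0 < A - K < m], so it
   exceeds 1. Right continuity at [z], where the value is 1, would keep the process below
   [expR 1]. *)
have : \forall u \near z^'+, False.
  near=> u.
  have zu : z < u by near: u; exact: nbhs_right_gt.
  have u0 : 0 <= u by rewrite (le_trans z0)// ltW.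
  have ur : u < z + r by near: u; apply: nbhs_right_lt; rewrite ltrDl.
  have low x : z <= x <= u -> m / 2 <= exp_mart B x w.
    move=> /andP[zx xu]; rewrite -extended_exp_martE; last exact: le_trans zx.
    apply/ltW/br => /=; rewrite distrC ger0_norm ?subr_ge0//.
    by rewrite ltrBlDl (le_lt_trans xu).
  have : A u < K + m by near: u.
  rewrite /A max_r// => AuK.
  have [C C0 mC] := exp_mart_bounded B cB w u.
  have /andP[+ _] : m / 2 * (u - z) <= exp_functional B u w - exp_functional B z w
      <= C * (u - z).
    apply: (exp_functional_increment B cB w z u _ _ z0 (ltW zu)).
    by move=> x zxu; rewrite low// mC//; case/andP: zxu => /(le_trans z0) -> ->.
  rewrite Az => AzAu.
  have pos : 0 < m / 2 * (u - z) by rewrite mulr_gt0 ?subr_gt0// divr_gt0.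
  have mu : m / 2 <= exp_mart B u w by apply: low; rewrite lexx ltW.
  have : expR (c * bond_exponent B c u w) < expR 1 by near: u.
  rewrite ltr_expR /bond_exponent mulrA.
  have dneg : 2 + exp_functional B u w * c < 0 by move: Kc pos AzAu; nra.
  rewrite ltr_ndivrMr// mul1r => h.
  by move: Kc mu h AuK; nra.
by move=> /filter_ex[].
Unshelve. all: by end_near.
Qed.

End explosion.

(** * Unboundedness of the exponential functional *)

Section large_exp_functional.
Context d (Omega : measurableType d) (R : realType) (P : probability Omega R).
Variables (F : R -> set (set Omega)) (B : R -> Omega -> R).
Hypotheses (filF : is_filtration F) (BM : standard_brownian_motion P F B).

Let cB : forall w, {within `[0, +oo[%classic, continuous (fun t => B t w)}.
Proof. by case: BM. Qed.

Let mB t : 0 <= t -> measurable_fun setT (B t).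
Proof. exact: measurable_brownian filF BM t. Qed.

Let integral_cst1 (r : R) : (\int[P]_w r%:E = r%:E)%E.
Proof.
rewrite integral_cst// [X in (_ * X)%E](_ : _ = 1%E) ?mule1//.
exact: probability_setT.
Qed.

Lemma brownian_mgf k s : 0 < s ->
  (\int[P]_w (expR (k * (B s w - B 0 w)))%:E = (expR (k ^+ 2 * s / 2))%:E)%E.
Proof.
move=> s0; pose f (z : R * R) := expR (k * z.2).
rewrite (increment_integral _ _ _ _ _ _ filF BM (fun=> 0) f 0 s (lexx 0) s0).
- rewrite subr0 /f/= normal_mgf; last by rewrite gt_eqF// sqrtr_gt0.
  by rewrite sqr_sqrtr ?(ltW s0)// integral_cst1.
- apply/(measurable_wrtP _ _ _ _ (filtration_sigma _ _ _ _ filF 0 (lexx 0))).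
  exact: measurable_cst.
- by move=> z; exact: expR_ge0.
- apply: measurableT_comp => //; apply: measurable_funM => //.
Qed.

Lemma brownian_event L s : 0 <= s -> F s [set w | L <= B s w].
Proof.
move=> s0; rewrite -preimage_itvcy.
by case: BM => + _ _ _ _; apply.
Qed.

(** If [B s < L] almost surely, then [e^(k^2 s / 2) = E[e^(k B_s)] <= e^(k L)] for every [k > 0], so
    [k s / 2 <= L]; this fails for [k = 2 (|L| + 1) / s]. *)
Lemma brownian_unbounded L s : 0 < s -> (0 < P [set w | (L <= B s w)%R])%E.
Proof.
move=> s0; set E := mkset _.
have mE : measurable E.
  exact: (filtration_sub _ _ _ _ filF s (ltW s0) _ (brownian_event L s (ltW s0))).
rewrite lt0e measure_ge0 andbT; apply/negP => /eqP PE0.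
have aeE : {ae P, forall w, ~ E w}.
  by exists E; split => //; move=> w /= /contrapT.
have ae0 : {ae P, forall w, B 0 w = 0} by case: BM.
have bound k : 0 < k -> k * s / 2 <= L.
  move=> k0; rewrite -(ler_pM2l k0) mulrA mulrA -expr2 -ler_expR -lee_fin.
  rewrite -brownian_mgf//.
  have -> : (expR (k * L))%:E = (\int[P]_w (expR (k * L))%:E)%E.
    by rewrite integral_cst1.
  apply: ae_ge0_le_integral => //.
  - apply/measurable_EFinP; apply: measurableT_comp => //.
    apply: measurable_funM => //.
    by apply: measurable_funB; apply: mB => //; exact: ltW.
  - apply: filterS2 aeE ae0 => w nE B0 _; rewrite lee_fin ler_expR ler_pM2l// B0 subr0.
    by rewrite leNgt; apply/negP => /ltW.
have := bound (2 * (`|L| + 1) / s).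
rewrite divr_gt0// ?mulr_gt0// ?ltr_wpDl// => /(_ isT).
rewrite divfK ?gt_eqF// mulrC mulKf//.
by have := ler_norm L; lra.
Qed.

(** The integrand is [M_s / M_u], independent of [E]. Its mean is [e^(u - s)]: half of the exponent
    is explicit, half comes from the Gaussian moment. *)
Lemma exp_increment_integral E s u : 0 <= s -> s <= u -> F s E ->
  (\int[P]_(w in E) (expR (- (B u w - B s w) + (u - s) / 2))%:E
   = (expR (u - s))%:E * P E)%E.
Proof.
move=> s0 su FE; have mE := filtration_sub _ _ _ _ filF s s0 E FE.
have [->|sNu] := eqVneq s u.
  under eq_integral do rewrite !subrr oppr0 mul0r addr0 expR0.
  by rewrite integral_cst// subrr expR0.
have {}su : s < u by rewrite lt_neqAle sNu.
(* The first coordinate will be the indicator of [E]; the absolute value makes [f] nonnegative on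
   the whole plane. *)
pose f (z : R * R) := `|z.1| * expR (- z.2 + (u - s) / 2).
have mf : measurable_fun setT f.
  apply: measurable_funM; first exact: measurableT_comp.
  apply: measurableT_comp => //; apply: measurable_funD => //.
  exact: measurableT_comp.
transitivity (\int[P]_w (f (\1_E w, B u w - B s w))%:E)%E.
  rewrite integral_mkcond; apply: eq_integral => w _.
  rewrite patchE indicE /f /=; case: ifP => _; first by rewrite normr1 mul1r.
  by rewrite normr0 mul0r.
rewrite (increment_integral _ _ _ _ _ _ filF BM \1_E f s u s0 su) //; first last.
- by move=> z; rewrite mulr_ge0// expR_ge0.
- apply/(measurable_wrtP _ _ _ _ (filtration_sigma _ _ _ _ filF s s0)).
  apply: measurable_indic; rewrite measurable_g_measurableTypeE//.
  exact: (filtration_sigma _ _ _ _ filF s s0).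
have inner y : (\int[normal_prob 0 (Num.sqrt (u - s))]_x (f (y, x))%:E
    = (`|y| * expR (u - s))%:E)%E.
  rewrite (_ : (fun x => _) = fun x : R =>
    ((`|y| * expR ((u - s) / 2))%:E * (expR (-1 * x))%:E)%E); last first.
    apply/funext => x; rewrite -EFinM /f/= -mulrA -expRD; congr (_ * expR _)%:E.
    by ring.
  rewrite ge0_integralZl//; last first.
    by apply/measurable_EFinP; apply: measurableT_comp => //; exact: measurable_funM.
  rewrite normal_mgf ?gt_eqF ?sqrtr_gt0 ?subr_gt0// sqr_sqrtr ?subr_ge0 ?(ltW su)//.
  rewrite -EFinM; congr EFin; rewrite -[LHS]mulrA -expRD; congr (_ * expR _).
  by field.
under eq_integral do rewrite inner.
rewrite (_ : (fun w => _) = fun w => ((expR (u - s))%:E * (\1_E w)%:E)%E); last first.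
  by apply/funext => w; rewrite -EFinM mulrC ger0_norm.
rewrite ge0_integralZl ?expR_ge0 ?integral_indic ?setIT//.
by apply/measurable_EFinP; exact: measurable_indic.
Qed.

Section lower_bound.
Variables (T K : R).
Hypotheses (T0 : 0 < T) (K0 : 0 < K).
Let s := T / 2.
Let a := T - s.
(** [theta] is the reciprocal of the bound [e^T] on the mean of [M_s / M_u], and [L] is chosen so
    that [expR (T - L) * K = a * theta / 2]. The inverse sums then exceed the bound on their mean by
    the factor 3 / 2. *)
Let theta := expR (- T).
Let L := T - ln (a * theta / (2 * K)).
Let E := [set w | L <= B s w].

Let s0 : 0 < s. Proof. by rewrite divr_gt0. Qed.
Let sT : s <= T. Proof. by have := T0; rewrite /s => ?; lra. Qed.
Let a0 : 0 < a. Proof. by have := T0; rewrite /a /s => ?; lra. Qed.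

(** The left Riemann sum of [M_s / M_u] for [u] in [[s, T]]. *)
Let inv_sum n w := \sum_(j < n.+1)
  expR (- (B (grid s T n j) w - B s w) + (grid s T n j - s) / 2) * (a / n.+1%:R).

(* [2 theta - theta^2 / x <= x] turns a lower bound on [A_T] into an upper
   bound on the integral of the inverse path. *)
Let inv_sum_ge n w : E w -> euler_functional B s T n n.+1 w <= K ->
  3 / 2 * (a * expR T) <= inv_sum n w.
Proof.
move=> Ew AK.
have th0 : 0 < theta by exact: expR_gt0.
have h0 : 0 <= a / n.+1%:R by rewrite divr_ge0 ?(ltW a0).
have eL : expR (T - L) = a * theta / (2 * K).
  by rewrite /L subKr lnK// posrE divr_gt0 ?mulr_gt0.
have term j : 2 * theta * (a / n.+1%:R) - theta ^+ 2 *
    (expR (- (B (grid s T n j) w - B s w) + (grid s T n j - s) / 2) * (a / n.+1%:R))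
    <= expR (T - L) * (exp_mart B (grid s T n j) w * (a / n.+1%:R)).
  set x := - (B _ w - B s w) + _; set h := a / _ in h0 *.
  rewrite (mulrA (theta ^+ 2)) (mulrA (expR (T - L))) -mulrBl ler_wpM2r//.
  apply: (@le_trans _ _ (expR (- x))).
    rewrite expRN -subr_ge0; have := expR_gt0 x; move: (expR x) => y y0.
    rewrite (_ : _ - _ = (theta * y - 1) ^+ 2 / y); last by field; rewrite gt_eqF.
    by rewrite divr_ge0 ?sqr_ge0// ltW.
  rewrite /exp_mart -expRD ler_expR /x.
  move: Ew T0; rewrite /E/= /s.
  by move: (B (T / 2) w) (B _ w) (grid _ _ _ _) => p q u; lra.
have sumE : \sum_(j < n.+1) (a / n.+1%:R) = a.
  by rewrite sumr_const card_ord -[LHS]mulr_natr divfK.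
have : 2 * theta * a - theta ^+ 2 * inv_sum n w <= expR (T - L) * K.
  rewrite -[X in _ * X - _]sumE /inv_sum !mulr_sumr -sumrB.
  apply: (@le_trans _ _ (expR (T - L) * euler_functional B s T n n.+1 w)).
    rewrite /euler_functional mulrDr ler_wpDl ?mulr_ge0 ?expR_ge0 ?exp_functional_ge0//.
    by rewrite mulr_sumr ler_sum.
  by rewrite ler_wpM2l ?expR_ge0.
rewrite eL (_ : a * theta / (2 * K) * K = a * theta / 2); last first.
  by field; rewrite gt_eqF.
have thT : theta * expR T = 1 by rewrite /theta -expRD addNr expR0.
move=> H; rewrite -(ler_pM2l (exprn_gt0 2 th0)).
rewrite (_ : theta ^+ 2 * _ = 3 / 2 * a * theta * (theta * expR T)); last by ring.
by rewrite thT; lra.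
Qed.

Let measurable_inv n j : measurable_fun setT (fun w =>
  expR (- (B (grid s T n j) w - B s w) + (grid s T n j - s) / 2)).
Proof.
apply: measurableT_comp => //; apply: measurable_funD => //.
apply: measurableT_comp => //; apply: measurable_funB; apply: mB; last exact: ltW.
by rewrite (le_trans (ltW s0))// grid_ge.
Qed.

Let inv_sum_integral n : (\int[P]_(w in E) (inv_sum n w)%:E <= (a * expR T)%:E * P E)%E.
Proof.
have FE : F s E by exact: brownian_event (ltW s0).
have mE := filtration_sub _ _ _ _ filF s (ltW s0) E FE.
have sg j : s <= grid s T n j by exact: grid_ge.
have mterm j : measurable_fun E (fun w =>
    (expR (- (B (grid s T n j) w - B s w) + (grid s T n j - s) / 2)
     * (a / n.+1%:R))%:E).
  apply/measurable_EFinP; apply: measurable_funTS.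
  by apply: measurable_funM => //; exact: measurable_inv.
have h0 : 0 <= a / n.+1%:R by rewrite divr_ge0 ?(ltW a0).
under eq_integral do rewrite -sumEFin.
rewrite ge0_integral_sum//; last first.
  by move=> j w _; rewrite lee_fin mulr_ge0 ?expR_ge0.
apply: (@le_trans _ _ (\sum_(j < n.+1) ((a / n.+1%:R)%:E * ((expR T)%:E * P E)))%E).
  apply: lee_sum => j _; under eq_integral do rewrite EFinM muleC.
  rewrite ge0_integralZl//; last first.
    by apply/measurable_EFinP; apply: measurable_funTS; exact: measurable_inv.
  rewrite exp_increment_integral ?(ltW s0)// lee_wpmul2l ?lee_fin//.
  rewrite lee_wpmul2r ?measure_ge0// lee_fin ler_expR.
  have := grid_le s T n sT j (ltnW (ltn_ord j)); have := ltW s0; lra.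
rewrite -ge0_sume_distrl; last by move=> j _; rewrite lee_fin.
rewrite sumEFin sumr_const card_ord -(mulr_natr (a / _)) divfK// muleA -EFinM.
exact: lexx.
Qed.

(** If [A_T < K] almost surely, the Riemann sums for [A_T] are also below [K] for large [n], so on
    [E] the inverse sums are eventually at least [rho = (3 / 2) a e^T]. Their integrals over [E] are
    at most [a e^T P(E)], which is impossible as [P(E) > 0]. Capping the sums at [rho] makes them
    converge boundedly to a constant on [E]. *)
Lemma exp_functional_exceeds : ~ {ae P, forall w, exp_functional B T w < K}.
Proof.
move=> aeK.
have FE : F s E by exact: brownian_event (ltW s0).
have mE := filtration_sub _ _ _ _ filF s (ltW s0) E FE.
have PE0 : (0 < P E)%E by exact: brownian_unbounded.
pose rho := 3 / 2 * (a * expR T).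
have r0 : 0 < a * expR T by rewrite mulr_gt0 ?expR_gt0.
have minv n : measurable_fun setT (inv_sum n).
  by apply: measurable_sum => j; apply: measurable_funM => //; exact: measurable_inv.
have inv0 n w : 0 <= inv_sum n w.
  by apply: sumr_ge0 => j _; rewrite mulr_ge0 ?expR_ge0// divr_ge0 ?(ltW a0).
have [] := @dominated_convergence _ _ _ P E mE
  (fun n w => (Num.min (inv_sum n w) rho)%:E) (cst rho%:E) (cst rho%:E).
- by move=> n; apply/measurable_EFinP; apply: measurable_funTS; exact: measurable_minr.
- exact: measurable_cst.
- apply: filterS aeK => w AK Ew.
  apply: cvg_near_cst.
  have /cvgr_lt/(_ _ AK) := euler_functional_end_cvg B cB s T w (ltW s0) sT.
  by apply: filterS => n /ltW AnK; rewrite min_r// inv_sum_ge.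
- exact: finite_measure_integrable_cst.
- apply: aeW => w n _; rewrite lee_fin ger0_norm ?ge_min ?lexx ?orbT//.
  by rewrite le_min inv0 mulr_ge0// ltW.
move=> _ _; rewrite integral_cst// => cv.
have : (rho%:E * P E <= (a * expR T)%:E * P E)%E.
  rewrite -(cvg_lim _ cv)//; apply: lime_le; first by apply/cvg_ex; eexists; exact: cv.
  apply: nearW => n; rewrite /= (le_trans _ (inv_sum_integral n))//.
  apply: ge0_le_integral => //.
  - by move=> w _; rewrite lee_fin le_min inv0 mulr_ge0// ltW.
  - by apply/measurable_EFinP; apply: measurable_funTS; exact: measurable_minr.
  - by apply/measurable_EFinP; apply: measurable_funTS.
  - by move=> w _; rewrite lee_fin ge_min lexx.
have PEfin : P E \is a fin_num by exact: fin_num_measure.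
rewrite -(fineK PEfin) -!EFinM lee_fin ler_pM2r ?fine_gt0 ?PE0 ?ltey_eq ?PEfin//.
by rewrite /rho; lra.
Qed.

End lower_bound.
End large_exp_functional.

(** * The equivalence for bond prices *)

Lemma discounted_bondE (Omega : Type) (R : realType) (B : R -> Omega -> R) (p ph : R) :
  0 < p -> 0 < ph -> discounted_bond B p ph
  = fun t w => expR (ln (p / ph) * bond_exponent B (ln (p / ph)) t w).
Proof.
move=> p0 ph0; apply/funext => t; apply/funext => w.
by rewrite /discounted_bond /powR gt_eqF ?divr_gt0// mulrC.
Qed.

Theorem proposition1p4 (d : measure_display) (Omega : measurableType d)
    (R : realType) (P : probability Omega R)
    (F : R -> set (set Omega)) (B : R -> Omega -> R)
    (T Th : R) (P0 : R -> R) :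
  is_filtration F ->
  standard_brownian_motion P F B ->
  0 < T -> T < Th ->
  0 < P0 T -> 0 < P0 Th ->
  positive_local_martingale P F T (discounted_bond B (P0 T) (P0 Th))
  <-> P0 Th <= P0 T.
Proof.
move=> filF BM T0 _ p0 ph0; rewrite discounted_bondE//.
set c := ln (P0 T / P0 Th).
have cE : (0 <= c) = (P0 Th <= P0 T).
  rewrite -[RHS](ler_pM2r (_ : 0 < (P0 Th)^-1)) ?invr_gt0//.
  by rewrite divff ?gt_eqF// -ln1 ler_ln ?posrE// divr_gt0.
rewrite -cE; split=> [[_ [_ cad _]]|c0]; last first.
  by split=> [t w _|]; [exact: expR_gt0|exact: bond_local_martingale].
rewrite leNgt; apply/negP => c0.
have cB : forall w, {within `[0, +oo[%classic, continuous (fun t => B t w)}.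
  by case: BM.
(* The denominator vanishes at the level [2 / - c]; the [+ 1] makes it strictly negative at [T].
   Almost sure cadlag paths would keep [A_T] almost surely below this level. *)
have K0 : 0 < 2 / - c + 1 by rewrite ltr_wpDl// divr_ge0// oppr_ge0 ltW.
apply: (exp_functional_exceeds _ _ _ P F B filF BM T (2 / - c + 1) T0 K0).
apply: filterS cad => w; apply: contraPP => /negP; rewrite -leNgt => KA.
apply: explosion_not_cadlag => //.
have nc : - c != 0 by rewrite oppr_eq0 lt_eqF.
have : 2 < exp_functional B T w * - c.
  by rewrite -ltr_pdivrMr ?oppr_gt0// (lt_le_trans _ KA)// ltrDl.
by rewrite mulrN; lra.
Qed.
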